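(* Let $(a_n)_{n\ge 1}$ be a positive, real-valued lacunary sequence. Let $\epsilon>0$, and let $I\subset\mathbb{R}$ be a bounded interval. Let $L=L(N)$ be a positive real-valued function of $N\in\mathbb{N}$ which is bounded below by a positive constant and satisfies $L(N)=O(N^{1-\epsilon})$ as $N\to\infty$. Then for any $\delta>0$, $$\mathrm{meas}\left\{\alpha\in I:\ \left|\Sigma_N^2(L,\alpha)-L\right|>\delta L\right\}=O_{\delta,\epsilon,I}\left(N^{-\epsilon/2}\right)$$ as $N\to\infty$.
   Context: A positive, real-valued lacunary sequence is a real sequence $(a_n)_{n\ge1}$ with $a_1>0$ for which there is a constant $C>1$ such that $a_{n+1}\ge C a_n$ for all $n\ge1$. Let $\chi=\chi_{[-1/2,1/2]}$ be the characteristic function of $[-1/2,1/2]$. For $\alpha\in\mathbb{R}$, $x\in[0,1)$, put $$S_N(L,\alpha)(x)=\sum_{j=1}^N\sum_{n\in\mathbb{Z}}\chi\left(\frac{\alpha a_j-x+n}{L/N}\right),\qquad \Sigma_N^2(L,\alpha)=\int_0^1\left(S_N(L,\alpha)(x)-L\right)^2dx,$$ with $L=L(N)$. ''meas'' is Lebesgue measure. The sequence $(a_n)$ and the function $L(\cdot)$ are fixed, and implied constants may also depend on them. *)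

(* Defs.v *)
From HB Require Import structures.
From mathcomp Require Import all_boot all_order all_algebra.
From mathcomp Require Import all_classical all_reals all_analysis.

Set Implicit Arguments.
Unset Strict Implicit.
Unset Printing Implicit Defensive.

Import Order.TTheory GRing.Theory Num.Theory.
Import numFieldNormedType.Exports.

Local Open Scope classical_set_scope.
Local Open Scope ring_scope.

(* Sequences are indexed from 1: the value [a 0] is never used. *)
Definition lacunary (R : realType) (a : nat -> R) : Prop :=
  0 < a 1%N /\
  exists2 C : R, 1 < C & forall n, (1 <= n)%N -> C * a n <= a n.+1.

Definition chi (R : realType) : R -> R := \1_(`[- 2^-1, 2^-1]).

(* The inner sum is the library's sum over the support; for [0 < l] and
   [0 < N], only finitely many integers [n] contribute, so it is the sum of
   the series over all of Z. *)
Definition S_ (R : realType) (a : nat -> R) (N : nat) (l alpha x : R) : R :=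
  \sum_(1 <= j < N.+1)
    \sum_(n \in [set: int]) chi ((alpha * a j - x + n%:~R) / (l / N%:R)).

Definition Sigma2 (R : realType) (a : nat -> R) (N : nat) (l alpha : R) : R :=
  \int[lebesgue_measure]_(x in `[0, 1]) (S_ a N l alpha x - l) ^+ 2.

(* Main.v *)
Require Import Defs.
From HB Require Import structures.
From mathcomp Require Import all_boot all_order all_algebra.
From mathcomp Require Import all_classical all_reals all_analysis.
From mathcomp Require Import measurable_realfun ring lra zify.
Import Order.TTheory GRing.Theory Num.Theory.
Import numFieldNormedType.Exports.
Local Open Scope classical_set_scope.
Local Open Scope ring_scope.


Set Implicit Arguments.
Unset Strict Implicit.
Unset Printing Implicit Defensive.

(** Write [h = L / N], let [f] be the 1-periodic indicator of the points at
    distance at most [h / 2] from an integer, and [g] the periodic convolution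
    of [f] with itself, a periodized tent of height [h] and mean [h ^+ 2].
    Expanding the square gives
    [Sigma2 = \sum_(j, k) g (alpha * (a j - a k)) - L ^+ 2].  The diagonal
    [j = k] produces the main term [L], and with [G = g - h ^+ 2] what is left
    is, up to the negligible [h * L], twice the sum over the pairs [j < k] of
    [G (alpha * (a k - a j))].  So the theorem says that these mean zero
    quantities cancel for most [alpha] (lemma [Sigma2_dev]).

    The pairs are split at a distance [r] of order [ln N].

    There are at most [r * N] near pairs, with [k - r <= j < k], and each has
    [L^1] norm of order [h ^+ 2]; hence their sum has [L^1] norm of order
    [r * h * L], which is small with respect to [L] (lemma [near_sum_norm]).

    The far pairs, with [j + r < k], are grouped into rows [Y k], one for each
    larger index [k], and one bounds the second moment of [\sum_k Y k].
    - Rows whose indices differ by at least [r] are almost uncorrelated: the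
      frequencies involved have ratio at least of order [C ^+ r], which beats
      any fixed power of [N] (lemmas [itg_ctent_decorr] and [far_row_decorr]).
    - For the at most [2 * r * N] other couples of rows, the second moment of a
      single row suffices.  In a row all frequencies [a k - a j] are close to
      [a k], while their differences [a j - a i] are much smaller: over the fast
      phase, [G] against its translate averages to the autocorrelation of [G]
      at the slow phase [alpha * (a j - a i)], again of mean zero.  Only the
      diagonal survives, and the second moment of a row is of order [N * h ^+ 3]
      (lemmas [itg_ctent_close] and [far_row_sqr]).
    Altogether the second moment is of order [r * N ^+ 2 * h ^+ 3], that is
    [r * h * L ^+ 2] (lemma [far_sum_sqr]).

    The inequalities of Markov and Chebyshev then bound the exceptional set by a
    constant times [r * h], and [r * h = O (ln N * N `^ (- eps))].

    No Fourier analysis is involved.  All the averaging is done by a single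
    lemma, [equidistribution]: if [F] is 1-periodic in its first variable and
    Lipschitz in the second, then integrating [F (D * x) x] over a bounded
    interval amounts, up to [O (1 / D)], to first averaging out the first
    variable. *)

(** * Integrals of bounded measurable functions over intervals *)

Section BoundedMeasurable.
Context {R : realType}.
Implicit Types (f g : R -> R) (u v w c M : R).

(** A class of integrands that is stable under every operation used below and
    integrable over all bounded intervals. *)
Definition bmeas f := measurable_fun setT f /\ exists M : R, forall x, `|f x| <= M.

Definition itg u v f : R := \int[lebesgue_measure]_(x in `[u, v]) f x.

Lemma bmeas_cst c : bmeas (fun=> c).
Proof. by split; [exact: measurable_cst | exists `|c|]. Qed.

Lemma bmeasD f g : bmeas f -> bmeas g -> bmeas (fun x => f x + g x).
Proof.
move=> [mf [A fA]] [mg [B gB]]; split; first exact: measurable_funD.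
by exists (A + B) => x; rewrite (le_trans (ler_normD _ _))// lerD.
Qed.

Lemma bmeasM f g : bmeas f -> bmeas g -> bmeas (fun x => f x * g x).
Proof.
move=> [mf [A fA]] [mg [B gB]]; split; first exact: measurable_funM.
by exists (A * B) => x; rewrite normrM ler_pM.
Qed.

Lemma bmeasN f : bmeas f -> bmeas (fun x => - f x).
Proof.
move=> [mf [A fA]]; split; first exact: measurableT_comp.
by exists A => x; rewrite normrN.
Qed.

Lemma bmeasB f g : bmeas f -> bmeas g -> bmeas (fun x => f x - g x).
Proof. by move=> bf bg; apply: bmeasD => //; exact: bmeasN. Qed.

Lemma bmeas_norm f : bmeas f -> bmeas (fun x => `|f x|).
Proof.
move=> [mf [A fA]]; split; first exact: measurableT_comp.
by exists A => x; rewrite normr_id.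
Qed.

Lemma bmeas_sum (T : Type) (s : seq T) (P : pred T) (F : T -> R -> R) :
  (forall i, bmeas (F i)) -> bmeas (fun x => \sum_(i <- s | P i) F i x).
Proof.
move=> bF; elim: s => [|i s ihs].
  by under eq_fun do rewrite big_nil; exact: bmeas_cst.
under eq_fun do rewrite big_cons.
by case: (P i) => //; apply: bmeasD.
Qed.

Lemma bmeas_affine f c d : bmeas f -> bmeas (fun x => f (c * x + d)).
Proof.
move=> [mf [A fA]]; split; last by exists A.
apply: (measurableT_comp mf) => //.
by apply: measurable_funD => //; exact: measurable_funM.
Qed.

Lemma lebesgue_itvcc u v : u <= v ->
  lebesgue_measure (`[u, v]%classic : set R) = (v - u)%:E.
Proof.
move=> uv; rewrite lebesgue_measure_itv /= lte_fin.
by case: ltgtP uv => // -> _; rewrite subrr.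
Qed.

Lemma bmeas_integrable u v f : bmeas f ->
  lebesgue_measure.-integrable `[u, v] (EFin \o f).
Proof.
move=> [mf [M fM]]; apply: measurable_bounded_integrable => //.
- have := @lebesgue_measure_itv R (`[u, v]); move=> /= ->; case: ifP => // _; exact: ltry.
- exact: measurable_funS mf.
- exists M; split; first by rewrite num_real.
  by move=> x Mx y _; rewrite /= (le_trans (fM y))// ltW.
Qed.

Lemma itgD u v f g : bmeas f -> bmeas g ->
  itg u v (fun x => f x + g x) = itg u v f + itg u v g.
Proof. by move=> bf bg; apply: RintegralD => //; apply: bmeas_integrable. Qed.

Lemma itgB u v f g : bmeas f -> bmeas g ->
  itg u v (fun x => f x - g x) = itg u v f - itg u v g.
Proof. by move=> bf bg; apply: RintegralB => //; apply: bmeas_integrable. Qed.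

Lemma itgZ u v c f : bmeas f -> itg u v (fun x => c * f x) = c * itg u v f.
Proof. by move=> bf; apply: RintegralZl => //; apply: bmeas_integrable. Qed.

Lemma itg_cst u v c : u <= v -> itg u v (fun=> c) = c * (v - u).
Proof. by move=> uv; rewrite /itg Rintegral_cst//= lebesgue_itvcc. Qed.

Lemma itg_sum u v (T : Type) (s : seq T) (P : pred T) (F : T -> R -> R) :
  u <= v -> (forall i, bmeas (F i)) ->
  itg u v (fun x => \sum_(i <- s | P i) F i x) = \sum_(i <- s | P i) itg u v (F i).
Proof.
move=> uv bF; elim: s => [|i s ihs].
  under [in LHS]eq_fun do rewrite big_nil.
  by rewrite big_nil itg_cst// mul0r.
under [in LHS]eq_fun do rewrite big_cons.
rewrite big_cons; case: (P i) => //.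
by rewrite itgD ?ihs//; exact: bmeas_sum.
Qed.

Lemma eq_itg u v f g : (forall x, u <= x <= v -> f x = g x) ->
  itg u v f = itg u v g.
Proof.
by move=> fg; apply: eq_Rintegral => x; rewrite inE/= in_itv/= => /fg.
Qed.

Lemma le_itg u v f g : bmeas f -> bmeas g ->
  (forall x, u <= x <= v -> f x <= g x) -> itg u v f <= itg u v g.
Proof.
move=> bf bg fg; apply: le_Rintegral => //; exact: bmeas_integrable.
Qed.

Lemma itg_ge0 u v f : (forall x, 0 <= f x) -> 0 <= itg u v f.
Proof. by move=> f0; apply: Rintegral_ge0. Qed.

Lemma itg_norm u v f : bmeas f -> `|itg u v f| <= itg u v (fun x => `|f x|).
Proof. by move=> bf; apply: le_normr_Rintegral => //; apply: bmeas_integrable. Qed.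

Lemma itg_norm_le u v M f : u <= v -> bmeas f ->
  (forall x, u <= x <= v -> `|f x| <= M) -> `|itg u v f| <= M * (v - u).
Proof.
move=> uv bf fM; rewrite -itg_cst// (le_trans (itg_norm _ _ bf))// le_itg//.
- exact: bmeas_norm.
- exact: bmeas_cst.
Qed.

Lemma itg_chasles u v w f : u <= v -> v <= w -> bmeas f ->
  itg u w f = itg u v f + itg v w f.
Proof.
move=> uv vw bf.
have := @Rintegral_itvB R f (BLeft u) (BRight w) v (bmeas_integrable _ _ bf).
rewrite !bnd_simp => /(_ uv vw) H.
rewrite /itg -(@Rintegral_itv_obnd_cbnd R v (BRight w)); last first.
  apply: integrableS (bmeas_integrable v w bf) => //.
  by apply: subset_itvr; rewrite bnd_simp.
by rewrite -H addrC subrK.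
Qed.

(** Lebesgue measure is determined by its values on half-open intervals, which
    translations preserve. *)
Lemma lebesgue_measure_shift c (A : set R) : measurable A ->
  pushforward lebesgue_measure
    ((fun x => x + c) : _ -> measurableTypeR R) A = lebesgue_measure A.
Proof.
move=> mA; apply/esym/lebesgue_measure_unique => //=.
  by apply: measurable_funD.
move=> mf _ [[x y]] _ <-; rewrite /pushforward.
have -> : (fun z : R => z + c) @^-1` `]x, y] = `]x - c, y - c]%classic.
  by apply/seteqP; split => z /=; rewrite !in_itv /=; lra.
rewrite !lebesgue_measure_itv /= !lte_fin ltrD2r.
by case: ifP => // _; rewrite -!EFinD; congr EFin; lra.
Qed.

Lemma itg_shift u v c f : bmeas f ->
  itg u v (fun x => f (x + c)) = itg (u + c) (v + c) f.
Proof.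
move=> bf.
have pre : ((fun z => z + c) : _ -> measurableTypeR R) @^-1` `[u + c, v + c]
    = `[u, v]%classic.
  by apply/seteqP; split => z /=; rewrite !in_itv /=; lra.
rewrite /itg /Rintegral; congr fine; symmetry.
transitivity (\int[pushforward lebesgue_measure
   ((fun x => (x + c)%R) : _ -> measurableTypeR R)]_(x in `[(u + c)%R, (v + c)%R]) (f x)%:E)%E.
- apply: eq_measure_integral => [|mc A mA _]; first exact: measurable_funD.
  exact/esym/lebesgue_measure_shift.
- rewrite integral_pushforward//.
- by rewrite pre.
- by apply: measurable_funD.
- by apply/measurable_EFinP; case: bf.
- rewrite pre; apply: (@bmeas_integrable u v (fun x => f (x + c))).
  by have := bmeas_affine 1 c bf; under eq_fun do rewrite mul1r.
Qed.

End BoundedMeasurable.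

Section Fubini.
Context {R : realType}.
Implicit Types (f g : R -> R) (F : R -> R -> R) (a b u v w c M Lam D : R).

Definition bmeas2 F := measurable_fun setT (fun p : R * R => F p.1 p.2) /\
  exists M : R, forall s t, `|F s t| <= M.

Lemma bmeas2_row F s : bmeas2 F -> bmeas (F s).
Proof.
move=> [mF [M FM]]; split; last by exists M.
exact: (measurableT_comp mF (pair1_measurable s)).
Qed.

Lemma bmeas2_col F t : bmeas2 F -> bmeas (fun s => F s t).
Proof.
move=> [mF [M FM]]; split; last by exists M => s.
exact: (measurableT_comp mF (pair2_measurable t)).
Qed.

Lemma itgE u v f : bmeas f ->
  (itg u v f)%:E = (\int[lebesgue_measure]_x (f x * \1_(`[u, v]) x)%:E)%E.
Proof.
move=> bf; rewrite /itg /Rintegral fineK; last first.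
  by apply: integrable_fin_num => //; exact: bmeas_integrable.
rewrite integral_mkcond; congr integral; apply/funext => x.
by rewrite patchE indicE; case: ifP => _; rewrite ?mulr1 ?mulr0.
Qed.

(** Tonelli's theorem gives measurability of partial integrals for nonnegative
    integrands; adding a constant reduces bounded integrands to that case. *)
Lemma ge0_bmeas2_itg F a b : bmeas2 F -> (forall s t, 0 <= F s t) ->
  measurable_fun setT (fun s => itg a b (F s)).
Proof.
move=> bF F0; apply/measurable_EFinP.
have bcF := bmeas2_row _ bF.
pose f : R * R -> \bar R := EFin \o (fun p : R * R => F p.1 p.2 * \1_(`[a, b]) p.2).
rewrite (_ : EFin \o _ = fubini_F lebesgue_measure f); last first.
  by apply/funext => s; rewrite /= itgE.
apply: measurable_fun_fubini_tonelli_F.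
- apply/measurable_EFinP; apply: measurable_funM; first by case: bF.
  by apply: (measurableT_comp _ measurable_snd); exact: measurable_indic.
- by move=> p /=; rewrite lee_fin mulr_ge0.
Qed.

Lemma bmeas2_itg F a b : a <= b -> bmeas2 F -> bmeas (fun s => itg a b (F s)).
Proof.
move=> ab bF; have bcF := fun s => bmeas2_row s bF.
have [mF [M FM]] := bF; split; last first.
  by exists (M * (b - a)) => s; apply: itg_norm_le => // x _; exact: FM.
pose P s t := F s t + M.
have bP : bmeas2 P.
  split; first by apply: measurable_funD.
  exists (M + `|M|) => s t; rewrite (le_trans (ler_normD _ _))// lerD//.
have P0 s t : 0 <= P s t.
  by have := FM s t; rewrite ler_norml /P => /andP[]; lra.
rewrite (_ : (fun s => _) = (fun s => itg a b (P s) - M * (b - a))).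
  apply: measurable_funB => //; exact: ge0_bmeas2_itg.
by apply/funext => s; rewrite itgD ?itg_cst ?addrK//; exact: bmeas_cst.
Qed.

Lemma bmeas2_swap F : bmeas2 F -> bmeas2 (fun s t => F t s).
Proof.
move=> [mF [M FM]]; split; last by exists M => s t.
apply: (measurableT_comp (f := fun p : R * R => F p.1 p.2)
  (g := fun p : R * R => (p.2, p.1))) => //.
exact: measurable_swap.
Qed.

Lemma ge0_itg_swap F u v a b : u <= v -> a <= b -> bmeas2 F ->
  (forall s t, 0 <= F s t) ->
  itg u v (fun s => itg a b (F s)) = itg a b (fun t => itg u v (fun s => F s t)).
Proof.
move=> uv ab bF F0; apply: EFin_inj.
have bL := bmeas2_itg ab bF; have bR := bmeas2_itg uv (bmeas2_swap bF).
rewrite [in LHS]itgE// [in RHS]itgE//.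
pose f : R * R -> \bar R := EFin \o
  (fun p : R * R => F p.1 p.2 * \1_(`[u, v]) p.1 * \1_(`[a, b]) p.2).
transitivity (\int[lebesgue_measure]_s \int[lebesgue_measure]_t f (s, t))%E.
  apply: eq_integral => s _; rewrite mulrC EFinM itgE; last exact: bmeas2_row.
  rewrite -ge0_integralZl_EFin//.
  - by apply: eq_integral => t _; rewrite /f/= -EFinM; congr EFin; ring.
  - by move=> t _; rewrite lee_fin mulr_ge0.
  - apply/measurable_EFinP; apply: measurable_funM; last exact: measurable_indic.
    by case: (bmeas2_row s bF).
rewrite fubini_tonelli.
- apply: eq_integral => t _; rewrite mulrC EFinM itgE; last exact: bmeas2_col.
  rewrite -ge0_integralZl_EFin//.
  - by apply: eq_integral => s _; rewrite /f/= -EFinM; congr EFin; ring.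
  - by move=> s _; rewrite lee_fin mulr_ge0.
  - apply/measurable_EFinP; apply: measurable_funM; last exact: measurable_indic.
    by case: (bmeas2_col t bF).
- apply/measurable_EFinP; apply: measurable_funM.
    apply: measurable_funM; first by case: bF.
    by apply: (measurableT_comp _ measurable_fst); exact: measurable_indic.
  by apply: (measurableT_comp _ measurable_snd); exact: measurable_indic.
- by move=> p; rewrite lee_fin !mulr_ge0.
Qed.

Lemma itg_swap F u v a b : u <= v -> a <= b -> bmeas2 F ->
  itg u v (fun s => itg a b (F s)) = itg a b (fun t => itg u v (fun s => F s t)).
Proof.
move=> uv ab bF.
have [mF [M FM]] := bF.
pose P s t := F s t + M.
have bP : bmeas2 P.
  split; first by apply: measurable_funD.
  exists (M + `|M|) => s t; rewrite (le_trans (ler_normD _ _))// lerD//.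
have P0 s t : 0 <= P s t.
  by have := FM s t; rewrite ler_norml /P => /andP[]; lra.
have bc := bmeas_cst.
have EL : itg u v (fun s => itg a b (P s)) =
    itg u v (fun s => itg a b (F s)) + M * (b - a) * (v - u).
  rewrite -itg_cst// -itgD//; last exact: bmeas2_itg.
  by apply: eq_itg => s _; rewrite itgD ?itg_cst//; exact: bmeas2_row.
have ER : itg a b (fun t => itg u v (fun s => P s t)) =
    itg a b (fun t => itg u v (fun s => F s t)) + M * (v - u) * (b - a).
  rewrite -itg_cst// -itgD//; last exact/bmeas2_itg/bmeas2_swap.
  by apply: eq_itg => t _; rewrite itgD ?itg_cst//; exact: bmeas2_col.
have := ge0_itg_swap uv ab bP P0; rewrite EL ER => H.
by apply: (addIr (M * (b - a) * (v - u))); rewrite H; congr (_ + _); ring.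
Qed.

End Fubini.

(** * Averaging over a fast periodic variable *)

Section Equidistribution.
Context {R : realType}.
Implicit Types (f g : R -> R) (F : R -> R -> R) (a b u v w c M Lam D : R).

Definition per1 f := forall x, f (x + 1) = f x.

Lemma per1_int f x (n : int) : per1 f -> f (x + n%:~R) = f x.
Proof.
move=> pf.
have pn (m : nat) y : f (y + m%:R) = f y.
  elim: m y => [|m ihm] y; first by rewrite addr0.
  by rewrite -addn1 natrD addrA pf.
case: n => m; first exact: pn.
by rewrite NegzE mulrNz -(pn m.+1 (x - m.+1%:R)) subrK.
Qed.

Lemma bmeas_shift f c : bmeas f -> bmeas (fun x => f (x + c)).
Proof. by move=> bf; have := bmeas_affine 1 c bf; under eq_fun do rewrite mul1r. Qed.

(** Shift [c] into [[0, 1[] by an integer, then move the piece beyond [1] back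
    by one period. *)
Lemma itg_per1 f c : bmeas f -> per1 f -> itg c (c + 1) f = itg 0 1 f.
Proof.
move=> bf pf.
pose n := Num.floor c; pose b := c - n%:~R.
have /andP[b0 b1] : 0 <= b < 1.
  have /andP[] := floor_itv c; rewrite /b -/n intrD; lra.
transitivity (itg b (b + 1) (fun x => f (x + n%:~R))).
  by rewrite itg_shift// (addrAC b) /b !subrK.
rewrite (eq_itg (g := f)); last by move=> x _; rewrite per1_int.
rewrite (@itg_chasles _ b 1)//; [|lra|lra].
rewrite [RHS](@itg_chasles _ 0 b)//; [|lra].
rewrite addrC; congr (_ + _).
rewrite -{1}(add0r 1) -itg_shift//.
by apply: eq_itg => x _; rewrite pf.
Qed.

Lemma bmeas2_comp_affine F p q c d :
  bmeas2 F -> bmeas2 (fun t s => F (p * s + q * t) (c * s + d * t)).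
Proof.
move=> [mF [M FM]]; split; last by exists M => s t.
apply: (measurableT_comp mF
  (g := fun z : R * R => (p * z.2 + q * z.1, c * z.2 + d * z.1))).
by apply: measurable_fun_pair; apply: measurable_funD; apply: measurable_funM.
Qed.

(** The fast variable [D * x] sweeps out [[0, 1]] while the slow variable [x]
    hardly moves.  Translating [x] by [t / D] changes the integral by at most
    the two end pieces and the variation in the slow variable; averaging over
    [t] in [[0, 1]] replaces the fast variable by its mean. *)
Lemma equidistribution F u v M Lam D :
  bmeas2 F -> (forall s t, F (s + 1) t = F s t) ->
  (forall s t, `|F s t| <= M) ->
  (forall s t t', `|F s t - F s t'| <= Lam * `|t - t'|) ->
  u <= v -> 0 < D ->
  `|itg u v (fun x => F (D * x) x) -
    itg u v (fun x => itg 0 1 (fun s => F s x))| <=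
  (2 * M + Lam * (v - u)) / D.
Proof.
move=> bF pF FM FL uv D0.
have M0 : 0 <= M := le_trans (normr_ge0 _) (FM 0 0).
have L0 : 0 <= Lam by have := le_trans (normr_ge0 _) (FL 0 1 0); rewrite subr0 normr1 mulr1.
pose phi x := F (D * x) x.
have bphi : bmeas phi.
  have := bmeas2_row 0 (bmeas2_comp_affine D 1 1 1 bF).
  by under eq_fun do rewrite !mulr0 !addr0 mul1r.
pose K t s := F (D * s + t) s.
have bK : bmeas2 K.
  have := bmeas2_comp_affine D 1 1 0 bF.
  rewrite /K; congr bmeas2; apply/funext => t; apply/funext => s.
  by rewrite !mul1r mul0r addr0.
pose B t := itg u v (K t).
have bB : bmeas B by exact: bmeas2_itg.
have AB t : 0 <= t <= 1 -> `|itg u v phi - B t| <= (2 * M + Lam * (v - u)) / D.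
  move=> /andP[t0 t1]; pose tau := t / D.
  have tau0 : 0 <= tau by rewrite divr_ge0// ltW.
  have tau1 : tau <= D^-1 by rewrite ler_pdivrMr// mulVf// gt_eqF.
  have B1 : `|itg (u + tau) (v + tau) phi - B t| <= Lam * tau * (v - u).
    rewrite -itg_shift// -itgB; [|exact: bmeas_shift|exact: bmeas2_row].
    apply: itg_norm_le => //.
      by apply: bmeasB; [exact: bmeas_shift|exact: bmeas2_row].
    move=> x _; rewrite /phi /K.
    have -> : D * (x + tau) = D * x + t by rewrite mulrDr [D * tau]mulrC divfK// gt_eqF.
    by rewrite (le_trans (FL _ _ _))// addrAC subrr add0r ger0_norm.
  have B2 : `|itg u v phi - itg (u + tau) (v + tau) phi| <= 2 * M * tau.
    have E1 := @itg_chasles _ u v (v + tau) phi uv.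
    have E2 := @itg_chasles _ u (u + tau) (v + tau) phi.
    have -> : itg u v phi - itg (u + tau) (v + tau) phi =
       itg u (u + tau) phi - itg v (v + tau) phi.
      have vt : v <= v + tau by lra.
      have ut : u <= u + tau by lra.
      have uvt : u + tau <= v + tau by lra.
      by have := E1 vt bphi; have := E2 ut uvt bphi; lra.
    rewrite (le_trans (ler_normB _ _))//.
    have := @itg_norm_le _ u (u + tau) M phi _ bphi (fun x _ => FM _ x).
    have := @itg_norm_le _ v (v + tau) M phi _ bphi (fun x _ => FM _ x).
    rewrite !lerDl !(addrC _ tau) !addrK => /(_ tau0) + /(_ tau0); lra.
  have -> : itg u v phi - B t = (itg u v phi - itg (u + tau) (v + tau) phi) +
     (itg (u + tau) (v + tau) phi - B t) by ring.
  rewrite (le_trans (ler_normD _ _))// (le_trans (lerD B2 B1))//.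
  have -> : 2 * M * tau + Lam * tau * (v - u) = (2 * M + Lam * (v - u)) * tau by ring.
  by rewrite ler_wpM2l// addr_ge0// mulr_ge0// subr_ge0.
have -> : itg u v (fun x => itg 0 1 (fun s => F s x)) = itg 0 1 B.
  rewrite [RHS](itg_swap ler01 uv bK); apply: eq_itg => x _.
  have bFx : bmeas (fun s => F s x) by exact: bmeas2_col.
  rewrite -(itg_per1 (D * x) bFx)//.
  rewrite -[X in itg X _ _]add0r [in X in itg _ X _]addrC -itg_shift//.
  by apply: eq_itg => s _; rewrite /K addrC.
have -> : itg u v (fun x => F (D * x) x) - itg 0 1 B = itg 0 1 (fun t => itg u v phi - B t).
  by rewrite itgB ?itg_cst ?subr0 ?mulr1//; exact: bmeas_cst.
rewrite (le_trans (itg_norm_le (M := (2 * M + Lam * (v - u)) / D) _ _ _))// ?subr0 ?mulr1//.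
by apply: bmeasB => //; exact: bmeas_cst.
Qed.

(** The case without slow variable: a dilated periodic function integrates to
    its mean up to one incomplete period. *)
Lemma equidistribution1 f u v M D : bmeas f -> per1 f -> (forall s, `|f s| <= M) ->
  u <= v -> 0 < D ->
  `|itg u v (fun x => f (D * x)) - itg 0 1 f * (v - u)| <= 2 * M / D.
Proof.
move=> bf pf fM uv D0.
have := @equidistribution (fun s _ => f s) u v M 0 D.
rewrite mul0r addr0 itg_cst//; apply => //.
- split; last by exists M.
  by apply: (measurableT_comp _ measurable_fst); case: bf.
- by move=> s t t'; rewrite subrr normr0 mul0r.
Qed.

End Equidistribution.

(** * The periodized tent and the expansion of the variance *)

Section Tent.
Context {R : realType}.
Implicit Types (f g : R -> R) (a b u v w c h x y z : R).

(** The inner sum of [S_]: by lemma [pindE], the indicator of the points at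
    distance at most [h / 2] from an integer. *)
Definition pind h y : R := \sum_(n \in [set: int]) chi ((y + n%:~R) / h).

Lemma chiE y : chi y = (`|y| <= 2^-1)%R%:R :> R.
Proof. by rewrite /chi indicE mem_setE in_itv /= -ler_norml. Qed.

(** Since [h < 1], only the integer nearest to [- y] can contribute. *)
Lemma pindE h y (m : int) : 0 < h < 1 -> `|y - m%:~R| <= (2^-1 : R) ->
  pind h y = (`|y - m%:~R| <= h / 2)%R%:R.
Proof.
move=> /andP[h0 h1] ym.
have lt_half (A B : R) : 1 <= A + B -> B <= 2^-1 -> 2^-1 * h < A by lra.
have chi0 (n : int) : n <> - m -> chi ((y + n%:~R) / h) = 0.
  move=> nm; rewrite chiE normrM normfV (gtr0_norm h0) ler_pdivrMr//.
  have : (1 : R) <= `|(n + m)%:~R|.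
    rewrite -intr_norm -[1]/(1%:~R) ler_int -gtz0_ge1 normr_gt0.
    by rewrite addr_eq0; apply/eqP.
  have -> : (n + m)%:~R = (y + n%:~R) - (y - m%:~R) :> R by rewrite intrD; ring.
  move=> H; have := lt_half _ _ (le_trans H (ler_normB _ _)) ym.
  by rewrite ltNge => /negbTE ->.
rewrite /pind -(@fsbig_widen _ _ 0 _ [set - m] setT)//.
  by rewrite fsbig_set1 chiE rmorphN normrM normfV (gtr0_norm h0) ler_pdivrMr// mulrC.
by move=> n [_ /= nm]; exact: chi0.
Qed.

Lemma near_int y : exists m : int, `|y - m%:~R| <= (2^-1 : R).
Proof.
exists (Num.floor (y + 2^-1)).
by have /andP[] := floor_itv (y + 2^-1); rewrite ler_norml intrD; lra.
Qed.

Lemma pind01 h y : 0 < h < 1 -> pind h y = 0 \/ pind h y = 1.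
Proof. by move=> h01; have [m /(pindE h01) ->] := near_int y; case: (_ <= _); [right|left]. Qed.

Lemma pind_norm h y : 0 < h < 1 -> `|pind h y| <= 1 :> R.
Proof. by move=> h01; case: (pind01 y h01) => ->; rewrite ?normr0 ?normr1. Qed.

Lemma pind_per1 h : 0 < h < 1 -> per1 (pind h).
Proof.
move=> h01 y; have [m ym] := near_int y; rewrite (pindE h01 ym).
have E : y + 1 - (m + 1)%:~R = y - m%:~R by rewrite intrD opprD addrACA subrr addr0.
by rewrite (@pindE _ _ (m + 1))// E.
Qed.

Lemma pindN h y : 0 < h < 1 -> pind h (- y) = pind h y.
Proof.
move=> h01; have [m ym] := near_int y; rewrite (pindE h01 ym).
have E : `|- y - (- m)%:~R| = `|y - m%:~R| by rewrite rmorphN -opprD normrN.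
by rewrite (@pindE _ _ (- m))// E.
Qed.

Lemma bmeas_pind h : 0 < h < 1 -> bmeas (pind h).
Proof.
move=> h01; have /andP[h0 h1] := h01.
split; last by exists 1 => y; exact: pind_norm.
rewrite (_ : pind h = \1_(\bigcup_(m : int) `[m%:~R - h / 2, m%:~R + h / 2]%classic)).
  by apply: measurable_indic; apply: countable_bigcupT_measurable => // m.
apply/funext => y; rewrite indicE; have [m ym] := near_int y.
rewrite (pindE h01 ym).
have [yh|yh] := boolP (_ <= _).
  by rewrite mem_set//; exists m => //=; rewrite in_itv/=; move: yh; rewrite ler_norml; lra.
rewrite memNset// => -[k _] /=; rewrite in_itv /= => yk.
move/negP: yh; apply.
have kh : `|y - k%:~R| <= h / 2 by rewrite ler_norml; lra.
have kh' : `|y - k%:~R| <= (2^-1 : R) by rewrite (le_trans kh)//; lra.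
have := pindE h01 kh'; rewrite (pindE h01 ym) kh.
by case: (_ <= _) => // /esym /eqP; rewrite oner_eq0.
Qed.

Lemma itg_pind_mul h f : 0 < h < 1 -> bmeas f ->
  itg (- 2^-1) 2^-1 (fun s => pind h s * f s) = itg (- (h / 2)) (h / 2) f.
Proof.
move=> h01 bf; have /andP[h0 h1] := h01; apply: EFin_inj.
rewrite !itgE//; last by apply: bmeasM => //; exact: bmeas_pind.
apply: eq_integral => s _; congr EFin; rewrite !indicE !mem_setE !in_itv /= -!ler_norml.
have [s2|s2] := boolP (`|s| <= 2^-1).
  rewrite (@pindE _ _ 0)// subr0// mulr1 mulrC//.
rewrite mulr0; case: (_ <= _) / idP => //; rewrite ?mulr0// => s3.
by move/negP: s2; case; rewrite (le_trans s3)//; lra.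
Qed.

(** For [0 < h < 1] this is the sum over the integers [n] of the tents
    [max(0, h - |w + n|)], and the periodic convolution of [pind h] with itself
    by lemma [itg_pind2]. *)
Definition tent h w : R := itg (w - h / 2) (w + h / 2) (pind h).

Lemma tent_shift h w : 0 < h < 1 ->
  tent h w = itg (- (h / 2)) (h / 2) (fun s => pind h (s + w)).
Proof.
by move=> h01; rewrite itg_shift ?(addrC _ w)//; exact: bmeas_pind.
Qed.

Lemma itg_pind2 h y z : 0 < h < 1 ->
  itg 0 1 (fun x => pind h (y - x) * pind h (z - x)) = tent h (y - z).
Proof.
move=> h01; have bp := bmeas_pind h01.
pose phi x := pind h (x - y) * pind h (x - z).
have bphi : bmeas phi by apply: bmeasM; exact: bmeas_shift.
rewrite (eq_itg (g := phi)); last first.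
  by move=> x _; rewrite -(pindN _ h01) -(pindN (z - x) h01) !opprB.
rewrite -(@itg_per1 _ phi (- 2^-1 + y))//; last first.
  by move=> x; rewrite /phi ![x + 1 + _]addrAC !pind_per1.
rewrite (_ : - 2^-1 + y + 1 = 2^-1 + y); last by lra.
rewrite -itg_shift// tent_shift// -itg_pind_mul//; last exact: bmeas_shift.
by apply: eq_itg => s _; rewrite /phi addrK addrA.
Qed.

Lemma tent0 h : 0 < h < 1 -> tent h 0 = h.
Proof.
move=> h01; have /andP[h0 h1] := h01.
rewrite tent_shift// (eq_itg (g := fun=> 1)); first by rewrite itg_cst; lra.
move=> s hs; rewrite addr0 (@pindE _ _ 0)// ?subr0 ler_norml; last by lra.
by have -> : - (h / 2) <= s <= h / 2 by lra.
Qed.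

Lemma itg_pind h y : 0 < h < 1 -> itg 0 1 (fun x => pind h (y - x)) = h.
Proof.
move=> h01; rewrite -[RHS]tent0// -[in RHS](subrr y) -itg_pind2//; apply: eq_itg => x _.
by case: (pind01 (y - x) h01) => ->; rewrite ?mulr0 ?mulr1.
Qed.

Lemma tentN h w : 0 < h < 1 -> tent h (- w) = tent h w.
Proof.
move=> h01; rewrite -[w]subr0 opprB -!itg_pind2//.
by apply: eq_itg => x _; rewrite mulrC.
Qed.

Lemma tent_per1 h : 0 < h < 1 -> per1 (tent h).
Proof.
move=> h01 w; rewrite !tent_shift//; apply: eq_itg => s _.
by rewrite addrA pind_per1.
Qed.

Lemma tent_ge0 h w : 0 < h < 1 -> 0 <= tent h w.
Proof. by move=> h01; apply: itg_ge0 => x; case: (pind01 x h01) => ->. Qed.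

Lemma tent_le h w : 0 < h < 1 -> tent h w <= h.
Proof.
move=> h01; have /andP[h0 h1] := h01.
rewrite -(ger0_norm (tent_ge0 w h01)).
have := @itg_norm_le _ (w - h / 2) (w + h / 2) 1 (pind h) _ (bmeas_pind h01).
have -> : w + h / 2 - (w - h / 2) = h by lra.
rewrite mul1r; apply; first by lra.
by move=> x _; exact: pind_norm.
Qed.

(** The windows at [w] and [w'] differ by two intervals of length [|w - w'|]. *)
Lemma tent_lip h w w' : 0 < h < 1 -> `|tent h w - tent h w'| <= 2 * `|w - w'|.
Proof.
move=> h01; have /andP[h0 h1] := h01.
wlog ww : w w' / w <= w'.
  move=> H; case: (leP w w') => [|/ltW] /H //.
  by rewrite distrC (distrC w).
have bp := bmeas_pind h01.
have len u v : u <= v -> `|itg u v (pind h)| <= v - u.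
  move=> uv; rewrite -[leRHS]mul1r; apply: itg_norm_le => // x _.
  exact: pind_norm.
have E1 : itg (w - h / 2) (w' + h / 2) (pind h) = tent h w + itg (w + h / 2) (w' + h / 2) (pind h).
  by apply: itg_chasles => //; lra.
have E2 : itg (w - h / 2) (w' + h / 2) (pind h) = itg (w - h / 2) (w' - h / 2) (pind h) + tent h w'.
  by apply: itg_chasles => //; lra.
have -> : tent h w - tent h w' = itg (w - h / 2) (w' - h / 2) (pind h) -
  itg (w + h / 2) (w' + h / 2) (pind h) by lra.
rewrite (le_trans (ler_normB _ _))//.
have := len (w - h / 2) (w' - h / 2); have := len (w + h / 2) (w' + h / 2).
rewrite distrC (ger0_norm (_ : 0 <= w' - w)) ?subr_ge0// => A B.
have {}A := A ltac:(lra); have {}B := B ltac:(lra); lra.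
Qed.

(** The mean of a convolution is the product of the means. *)
Lemma itg_tent h : 0 < h < 1 -> itg 0 1 (tent h) = h ^+ 2.
Proof.
move=> h01; have /andP[h0 h1] := h01.
have bp := bmeas_pind h01.
rewrite (eq_itg (g := fun w => itg (- (h / 2)) (h / 2) (fun s => pind h (s + w)))); last first.
  by move=> w _; rewrite tent_shift.
rewrite itg_swap//; [|lra|]; last first.
  split; last by exists 1 => s t; exact: pind_norm.
  case: bp => mp _; apply: (measurableT_comp mp (g := fun p : R * R => p.2 + p.1)).
  exact: measurable_funD.
rewrite (eq_itg (g := fun=> h)); first by rewrite itg_cst; [field|lra].
move=> s _; rewrite -[RHS](@itg_pind h 0)//.
transitivity (itg s (s + 1) (pind h)).
  by have := itg_shift 0 1 s bp; rewrite add0r (addrC 1) => <-; apply: eq_itg => t _; rewrite addrC.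
rewrite itg_per1//; last exact: pind_per1.
by apply: eq_itg => t _; rewrite sub0r pindN.
Qed.

(** Expand the square; each product of two indicators integrates to a value of
    the tent, and each single indicator to [l / N]. *)
Lemma Sigma2E (a : nat -> R) N (l alpha : R) :
  (0 < N)%N -> 0 < l -> l / N%:R < 1 ->
  Sigma2 a N l alpha =
  \sum_(1 <= j < N.+1) \sum_(1 <= k < N.+1)
     tent (l / N%:R) (alpha * a j - alpha * a k) - l ^+ 2.
Proof.
move=> N0 l0 lN; pose h := l / N%:R.
have h01 : 0 < h < 1 by rewrite divr_gt0 ?ltr0n.
have bp := bmeas_pind h01.
have bpr y : bmeas (fun x => pind h (y - x)).
  have := bmeas_affine (-1) y bp.
  by under eq_fun do rewrite mulN1r addrC.
pose P j x := pind h (alpha * a j - x).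
have bP j : bmeas (P j) by exact: bpr.
have bPP j k : bmeas (fun x => P j x * P k x) by exact: bmeasM.
have bS : bmeas (fun x => \sum_(1 <= j < N.+1) P j x) by exact: bmeas_sum.
have bSS : bmeas (fun x => \sum_(1 <= j < N.+1) \sum_(1 <= k < N.+1) P j x * P k x).
  by apply: bmeas_sum => j; apply: bmeas_sum.
have bc := bmeas_cst.
transitivity (itg 0 1 (fun x => \sum_(1 <= j < N.+1) \sum_(1 <= k < N.+1) P j x * P k x
  - 2 * l * \sum_(1 <= j < N.+1) P j x + l ^+ 2)).
  apply: eq_itg => x _; rewrite /S_ -/h.
  rewrite (_ : \sum_(1 <= j < N.+1) _ = \sum_(1 <= j < N.+1) P j x)//.
  under [X in _ = X - _ + _]eq_bigr do rewrite -mulr_sumr.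
  by rewrite -mulr_suml; ring.
rewrite itgD//; last by apply: bmeasB => //; exact: bmeasM.
rewrite itgB//; last by exact: bmeasM.
rewrite itg_cst// itgZ// !itg_sum//; last by move=> j; exact: bmeas_sum.
under eq_bigr do rewrite itg_sum//.
under eq_bigr do under eq_bigr do rewrite itg_pind2//.
under [X in _ - _ * X]eq_bigr do rewrite itg_pind//.
have -> : \sum_(1 <= j < N.+1) h = l.
  by rewrite sumr_const_nat subn1 /= -mulr_natr /h divfK// pnatr_eq0 -lt0n.
by rewrite -/h; ring.
Qed.

End Tent.

(** * Correlations of dilated centred tents *)

Section Correlations.
Context {R : realType}.
Implicit Types (f g : R -> R) (a b u v w c h x y z D d : R).

Definition ctent h y : R := tent h y - h ^+ 2.

Lemma bmeas_tent h : 0 < h < 1 -> bmeas (tent h).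
Proof.
move=> h01; have bp := bmeas_pind h01; have /andP[h0 h1] := h01.
rewrite (_ : tent h = fun w => itg (- (h / 2)) (h / 2) (fun s => pind h (s + w))).
  apply: bmeas2_itg; first by lra.
  split; last by exists 1 => s t; exact: pind_norm.
  case: bp => mp _; apply: (measurableT_comp mp (g := fun p : R * R => p.2 + p.1)).
  exact: measurable_funD.
by apply/funext => w; rewrite tent_shift.
Qed.

Lemma bmeas_ctent h : 0 < h < 1 -> bmeas (ctent h).
Proof. by move=> h01; apply: bmeasB; [exact: bmeas_tent|exact: bmeas_cst]. Qed.

Lemma ctent_norm h y : 0 < h < 1 -> `|ctent h y| <= h.
Proof.
move=> h01; have := tent_ge0 y h01; have := tent_le y h01.
have /andP[h0 h1] := h01; have : h ^+ 2 <= h by rewrite expr2 ger_pMl// ltW.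
by have := sqr_ge0 h; rewrite ler_norml /ctent; lra.
Qed.

Lemma ctent_per1 h : 0 < h < 1 -> per1 (ctent h).
Proof. by move=> h01 y; rewrite /ctent tent_per1. Qed.

Lemma ctent_lip h y z : 0 < h < 1 -> `|ctent h y - ctent h z| <= 2 * `|y - z|.
Proof.
by move=> h01; rewrite /ctent opprB addrA subrK; exact: tent_lip.
Qed.

Lemma itg_ctent h : 0 < h < 1 -> itg 0 1 (ctent h) = 0.
Proof.
move=> h01; rewrite itgB; [|exact: bmeas_tent|exact: bmeas_cst].
by rewrite itg_tent// itg_cst//; ring.
Qed.

Lemma itg_ctent_norm h : 0 < h < 1 -> itg 0 1 (fun y => `|ctent h y|) <= 2 * h ^+ 2.
Proof.
move=> h01; have bt := bmeas_tent h01; have bc := bmeas_cst (h ^+ 2).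
apply: (@le_trans _ _ (itg 0 1 (fun y => tent h y + h ^+ 2))).
  apply: le_itg; [exact/bmeas_norm/bmeas_ctent|exact: bmeasD|].
  move=> y _; rewrite (le_trans (ler_normB _ _))//.
  by rewrite !ger0_norm ?sqr_ge0// tent_ge0.
by rewrite itgD// itg_tent// itg_cst//; lra.
Qed.

(** The supremum norm [h] times the [L^1] norm; this saves a factor [h] over
    the trivial bound [h ^+ 2]. *)
Lemma itg_ctent_sqr h : 0 < h < 1 -> itg 0 1 (fun y => ctent h y ^+ 2) <= 2 * h ^+ 3.
Proof.
move=> h01; have bt := bmeas_ctent h01; have /andP[h0 h1] := h01.
apply: (@le_trans _ _ (itg 0 1 (fun y => h * `|ctent h y|))).
  apply: le_itg; [exact: bmeasM|by apply: bmeasM; [exact: bmeas_cst|exact: bmeas_norm]|].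
  by move=> y _; rewrite -real_normK ?num_real// expr2 ler_wpM2r// ctent_norm.
rewrite itgZ; last exact: bmeas_norm.
have := itg_ctent_norm h01; rewrite -(ler_pM2l h0) => /le_trans; apply.
by rewrite le_eqVlt; apply/orP; left; apply/eqP; ring.
Qed.

Lemma bmeas2_prod f g p q c d : bmeas f -> bmeas g ->
  bmeas2 (fun s t => f (p * s + q * t) * g (c * s + d * t)).
Proof.
move=> [mf [A fA]] [mg [B gB]]; split; last first.
  by exists (A * B) => s t; rewrite normrM ler_pM.
have ml p' q' : measurable_fun setT (fun z : R * R => p' * z.1 + q' * z.2).
  by apply: measurable_funD; apply: measurable_funM.
apply: measurable_funM; first exact: (measurableT_comp mf (ml p q)).
exact: (measurableT_comp mg (ml c d)).
Qed.

Lemma itg_ctent_dilate_norm h u v D : 0 < h < 1 -> u <= v -> 0 < D ->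
  itg u v (fun x => `|ctent h (D * x)|) <= 2 * h ^+ 2 * (v - u) + 2 * h / D.
Proof.
move=> h01 uv D0.
have := @equidistribution1 _ (fun y => `|ctent h y|) u v h D.
move=> /(_ (bmeas_norm (bmeas_ctent h01))).
have pn : per1 (fun y => `|ctent h y|) by move=> y; rewrite ctent_per1.
have bn y : `| `|ctent h y| | <= h by rewrite normr_id ctent_norm.
move=> /(_ pn bn uv D0); rewrite ler_norml => /andP[_].
rewrite lerBlDl => /le_trans; apply; rewrite lerD2r.
by rewrite ler_wpM2r ?subr_ge0// itg_ctent_norm.
Qed.

Lemma itg_ctent_dilate_sqr h u v D : 0 < h < 1 -> u <= v -> 0 < D ->
  itg u v (fun x => ctent h (D * x) ^+ 2) <= 2 * h ^+ 3 * (v - u) + 2 * h ^+ 2 / D.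
Proof.
move=> h01 uv D0; have bG := bmeas_ctent h01.
have := @equidistribution1 _ (fun y => ctent h y ^+ 2) u v (h ^+ 2) D.
move=> /(_ (bmeasM bG bG)).
have pn : per1 (fun y => ctent h y ^+ 2) by move=> y; rewrite ctent_per1.
have bn y : `| ctent h y ^+ 2 | <= h ^+ 2.
  by rewrite normrX lerXn2r ?nnegrE ?ctent_norm//; case/andP: h01 => /ltW.
move=> /(_ pn bn uv D0); rewrite ler_norml => /andP[_].
rewrite lerBlDl => /le_trans; apply; rewrite lerD2r.
by rewrite ler_wpM2r ?subr_ge0// itg_ctent_sqr.
Qed.

(** Meant for [D] much smaller than [D']: the first factor is then a slowly
    varying weight in front of the second, which has mean zero. *)
Lemma itg_ctent_decorr h u v D D' : 0 < h < 1 -> u <= v -> 0 < D -> 0 < D' ->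
  `|itg u v (fun x => ctent h (D * x) * ctent h (D' * x))| <=
  (2 * h ^+ 2 + 2 * h * D * (v - u)) / D'.
Proof.
move=> h01 uv D0 D'0; have bG := bmeas_ctent h01; have /andP[h0 h1] := h01.
have := @equidistribution _ (fun s x => ctent h s * ctent h (D * x)) u v
  (h ^+ 2) (2 * h * D) D'.
rewrite (eq_itg (u := u) (g := fun x => ctent h (D * x) * ctent h (D' * x))); last first.
  by move=> x _; rewrite mulrC.
have -> : itg u v (fun x => itg 0 1 (fun s => ctent h s * ctent h (D * x))) = 0.
  rewrite (eq_itg (g := fun=> 0)) ?itg_cst ?mul0r// => x _.
  rewrite (eq_itg (g := fun s => ctent h (D * x) * ctent h s)); last first.
    by move=> s _; rewrite mulrC.
  by rewrite itgZ// itg_ctent// mulr0.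
rewrite subr0; apply => //.
- have := bmeas2_prod 1 0 0 D bG bG; congr bmeas2.
  by apply/funext => s; apply/funext => t; rewrite !mul0r add0r addr0 mul1r.
- by move=> s t; rewrite ctent_per1.
- by move=> s t; rewrite normrM expr2 ler_pM// ctent_norm.
- move=> s t t'; rewrite -mulrBr normrM.
  have -> : 2 * h * D * `|t - t'| = h * (2 * (D * `|t - t'|)) by ring.
  rewrite ler_pM ?ctent_norm// (le_trans (ctent_lip _ _ h01))//.
  by rewrite -mulrBr normrM (gtr0_norm D0).
Qed.

Let autocorr h y := itg 0 1 (fun s => ctent h s * ctent h (s + y)).

Let bmeas2_autocorr h : 0 < h < 1 -> bmeas2 (fun y s => ctent h s * ctent h (s + y)).
Proof.
move=> h01; have bG := bmeas_ctent h01.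
have := bmeas2_prod 0 1 1 1 bG bG; congr bmeas2.
by apply/funext => s; apply/funext => t; rewrite mul0r add0r !mul1r addrC (addrC t).
Qed.

Let autocorr_norm h y : 0 < h < 1 -> `|autocorr h y| <= 2 * h ^+ 3.
Proof.
move=> h01; have bG := bmeas_ctent h01; have /andP[h0 h1] := h01.
have bGG := bmeas2_row y (bmeas2_autocorr h01).
rewrite (le_trans (itg_norm _ _ bGG))//.
apply: (@le_trans _ _ (itg 0 1 (fun s => h * `|ctent h s|))).
  apply: le_itg; [exact: bmeas_norm|by apply: bmeasM; [exact: bmeas_cst|exact: bmeas_norm]|].
  by move=> s _; rewrite normrM mulrC ler_wpM2r// ctent_norm.
rewrite itgZ; last exact: bmeas_norm.
have := itg_ctent_norm h01; rewrite -(ler_pM2l h0) => /le_trans; apply.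
by rewrite le_eqVlt; apply/orP; left; apply/eqP; ring.
Qed.

Let itg_autocorr h : 0 < h < 1 -> itg 0 1 (autocorr h) = 0.
Proof.
move=> h01; have bG := bmeas_ctent h01.
rewrite itg_swap//; last exact: bmeas2_autocorr.
rewrite (eq_itg (g := fun=> 0)); first by rewrite itg_cst// mul0r.
move=> s _; rewrite itgZ; last first.
  by have := bmeas_shift s bG; under eq_fun do rewrite addrC.
rewrite (_ : itg 0 1 (fun y => ctent h (s + y)) = 0) ?mulr0//.
transitivity (itg 0 1 (fun y => ctent h (y + s))).
  by apply: eq_itg => t _; rewrite addrC.
rewrite (itg_shift 0 1 s bG) add0r [1 + s]addrC.
by rewrite (itg_per1 s bG (ctent_per1 h01)) itg_ctent.
Qed.

(** Meant for [d] much smaller than [D], so that the two frequencies nearly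
    agree: averaging over the fast phase [D * x] leaves the autocorrelation of the
    centred tent at [d * x], which again has mean zero, and is itself averaged
    at the frequency [d]. *)
Lemma itg_ctent_close h u v D d : 0 < h < 1 -> u <= v -> 0 < D -> 0 < d ->
  `|itg u v (fun x => ctent h (D * x) * ctent h ((D + d) * x))| <=
  (2 * h ^+ 2 + 2 * h * d * (v - u)) / D + 4 * h ^+ 3 / d.
Proof.
move=> h01 uv D0 d0; have bG := bmeas_ctent h01; have /andP[h0 h1] := h01.
have E1 : `|itg u v (fun x => ctent h (D * x) * ctent h ((D + d) * x))
    - itg u v (fun x => autocorr h (d * x))| <= (2 * h ^+ 2 + 2 * h * d * (v - u)) / D.
  have := @equidistribution _ (fun s x => ctent h s * ctent h (s + d * x)) u v
    (h ^+ 2) (2 * h * d) D.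
  rewrite (eq_itg (u := u) (g := fun x => ctent h (D * x) * ctent h ((D + d) * x))); last first.
    by move=> x _; rewrite (mulrDl D d x).
  apply => //.
  - have := bmeas2_prod 1 0 1 d bG bG; congr bmeas2.
    by apply/funext => s; apply/funext => t; rewrite !mul0r addr0 mul1r.
  - by move=> s t; rewrite addrAC !ctent_per1.
  - by move=> s t; rewrite normrM expr2 ler_pM// ctent_norm.
  - move=> s t t'; rewrite -mulrBr normrM.
    have -> : 2 * h * d * `|t - t'| = h * (2 * (d * `|t - t'|)) by ring.
    rewrite ler_pM ?ctent_norm// (le_trans (ctent_lip _ _ h01))//.
    have -> : s + d * t - (s + d * t') = d * (t - t') by ring.
    by rewrite normrM (gtr0_norm d0).
have bH : bmeas (autocorr h) by apply: bmeas2_itg => //; exact: bmeas2_autocorr.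
have pH : per1 (autocorr h).
  by move=> y; apply: eq_itg => s _; rewrite addrA ctent_per1.
have nH y : `|autocorr h y| <= 2 * h ^+ 3 by exact: autocorr_norm.
have := equidistribution1 bH pH nH uv d0.
rewrite (itg_autocorr h01) mul0r subr0 (mulrA 2 2) -natrM => E2.
rewrite -[X in `|X|](subrK (itg u v (fun x => autocorr h (d * x)))).
by rewrite (le_trans (ler_normD _ _))// lerD.
Qed.

End Correlations.

(** * Lacunary sequences *)

Lemma sum_window (R : realType) (n m w : nat) (P : pred nat) (c : R) :
  0 <= c -> (forall j, P j -> (m <= j < m + w)%N) ->
  \sum_(1 <= j < n | P j) c <= w%:R * c.
Proof.
move=> c0 Pw; rewrite big_const_seq iter_addr_0 -[leLHS]mulr_natl ler_wpM2r// ler_nat.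
rewrite -size_filter -(size_iota m w) uniq_leq_size ?filter_uniq ?iota_uniq//.
by move=> j; rewrite mem_filter mem_iota => /andP[/Pw].
Qed.

Lemma ler_sum_cond (R : realType) (n : nat) (P : pred nat) (E F : nat -> R) :
  (forall j, (1 <= j)%N -> P j -> E j <= F j) ->
  (forall j, (1 <= j)%N -> 0 <= F j) ->
  \sum_(1 <= j < n | P j) E j <= \sum_(1 <= j < n) F j.
Proof.
move=> EF F0; rewrite big_mkcond/= big_seq_cond [leRHS]big_seq_cond.
apply: ler_sum => j /andP[]; rewrite mem_index_iota => /andP[j1 _] _.
by case: ifP => [Pj|_]; [exact: EF|exact: F0].
Qed.

Lemma sum_cst_nat (R : realType) N (c : R) : \sum_(1 <= j < N.+1) c = N%:R * c.
Proof. by rewrite sumr_const_nat subn1 mulr_natl. Qed.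

Section Lacunary.
Context {R : realType}.
Variables (a : nat -> R) (C : R).
Definition gap_ratio : R := 1 - C^-1.
Notation kap := gap_ratio.

Definition lacunary_by := [/\ 0 < a 1%N, 1 < C & forall n, (1 <= n)%N -> C * a n <= a n.+1].

Lemma lac_gt0 n : lacunary_by -> (1 <= n)%N -> 0 < a n.
Proof.
move=> [a1 C1 aC]; elim: n => // -[|n] ihn _ //.
by rewrite (lt_le_trans _ (aC n.+1 isT))// mulr_gt0 ?ihn//; lra.
Qed.

Lemma lac_pow j r : lacunary_by -> (1 <= j)%N -> C ^+ r * a j <= a (j + r)%N.
Proof.
move=> la j1; have [a1 C1 aC] := la; elim: r => [|r ihr]; first by rewrite addn0 mul1r.
rewrite addnS (le_trans _ (aC _ _))//; last by rewrite (leq_trans j1)// leq_addr.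
by rewrite exprS -mulrA ler_wpM2l//; lra.
Qed.

Lemma lac_powle j k r : lacunary_by -> (1 <= j)%N -> (j + r <= k)%N -> C ^+ r * a j <= a k.
Proof.
move=> la j1 jk; have [a1 C1 aC] := la; rewrite (le_trans _ (_ : C ^+ (k - j) * a j <= _))//.
  rewrite ler_wpM2r ?(ltW (lac_gt0 _ _))// ler_weXn2l//; [lra|lia].
by have := lac_pow (k - j) la j1; rewrite subnKC//; lia.
Qed.

Lemma lac_le j k : lacunary_by -> (1 <= j)%N -> (j <= k)%N -> a j <= a k.
Proof. by move=> la j1 jk; have := @lac_powle j k 0 la j1; rewrite addn0 expr0 mul1r; apply. Qed.

Lemma gap_ratio_gt0 : lacunary_by -> 0 < kap.
Proof. by move=> [_ C1 _]; rewrite subr_gt0 invf_lt1//; lra. Qed.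

(** Each difference [a k - a j] is comparable with its larger term. *)
Lemma lac_gap j k : lacunary_by -> (1 <= j)%N -> (j < k)%N -> kap * a k <= a k - a j.
Proof.
move=> la j1 jk; have [a1 C1 aC] := la.
have C0 : 0 < C by lra.
have : C * a j <= a k by have := @lac_powle j k 1 la j1; rewrite addn1 expr1; apply.
rewrite -(ler_pdivlMl _ _ C0) mulrC /kap => ?.
by rewrite mulrBl mul1r lerD2l lerN2 mulrC.
Qed.

Lemma lac_sub_gt0 j k : lacunary_by -> (1 <= j)%N -> (j < k)%N -> 0 < a k - a j.
Proof.
move=> la j1 jk; rewrite (lt_le_trans _ (lac_gap la j1 jk))// mulr_gt0 ?gap_ratio_gt0// lac_gt0//.
by rewrite (leq_trans j1)// ltnW.
Qed.

(** The sum telescopes: [1 / a k] is at most [1 / kap] times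
    [1 / a k - 1 / a k.+1]. *)
Lemma lac_sum_inv N : lacunary_by -> \sum_(1 <= k < N.+1) (a k)^-1 <= (kap * a 1)^-1.
Proof.
move=> la; have k0 := gap_ratio_gt0 la; have [a1 C1 aC] := la.
suff H : \sum_(1 <= k < N.+1) (a k)^-1 + (kap * a N.+1)^-1 <= (kap * a 1%N)^-1.
  rewrite (le_trans _ H)// lerDl invr_ge0 mulr_ge0 ?ltW// lac_gt0//.
elim: N => [|N ihN]; first by rewrite big_geq// add0r.
rewrite big_nat_recr//= (le_trans _ ihN)// -addrA lerD2l.
have x0 : 0 < a N.+1 by exact: lac_gt0.
have y0 : 0 < a N.+2 by exact: lac_gt0.
have C0 : 0 < C by lra.
have xy : (a N.+2)^-1 <= C^-1 * (a N.+1)^-1.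
  by rewrite -invfM lef_pV2 ?posrE ?mulr_gt0// aC.
rewrite !invfM.
have kK : kap * kap^-1 = 1 by rewrite divff// gt_eqF.
have K0 : 0 <= kap^-1 by rewrite invr_ge0 ltW.
move: kap^-1 kK K0 => K kK K0.
have -> : K * (a N.+1)^-1 = (a N.+1)^-1 + K * (C^-1 * (a N.+1)^-1).
  by rewrite -[X in _ = X + _]mul1r -kK /gap_ratio; ring.
by rewrite lerD2l ler_wpM2l.
Qed.

End Lacunary.

(** * Moments of the near and far sums *)

Section PairSums.
Context {R : realType}.
Implicit Types (a : nat -> R) (C h u v x : R) (i j k r N : nat).

Definition pair_dev a h j k x : R := ctent h ((a k - a j) * x).

Definition near_sum a h r N x : R :=
  \sum_(1 <= k < N.+1) \sum_(1 <= j < N.+1 | (j < k <= j + r)%N) pair_dev a h j k x.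

Definition far_row a h r N k x : R :=
  \sum_(1 <= j < N.+1 | (j + r < k)%N) pair_dev a h j k x.

Definition far_sum a h r N x : R := \sum_(1 <= k < N.+1) far_row a h r N k x.

(** [C ^- r * sep_err a C u v] bounds the error made when averaging at
    the frequency of a pair while the rest varies at a frequency at most [a j] for
    some [j] that is [r] steps below; see lemma [sep_err_bound]. *)
Definition sep_err a C u v : R := 2 / (gap_ratio C * a 1%N) + 2 * (v - u) / gap_ratio C.

Lemma bmeas_pair_dev a h j k : 0 < h < 1 -> bmeas (pair_dev a h j k).
Proof.
move=> h01; have := bmeas_affine (a k - a j) 0 (bmeas_ctent h01).
by under eq_fun do rewrite addr0.
Qed.

Lemma bmeas_near_sum a h r N : 0 < h < 1 -> bmeas (near_sum a h r N).
Proof. by move=> h01; apply: bmeas_sum => k; apply: bmeas_sum => j; exact: bmeas_pair_dev. Qed.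

Lemma bmeas_far_row a h r N k : 0 < h < 1 -> bmeas (far_row a h r N k).
Proof. by move=> h01; apply: bmeas_sum => j; exact: bmeas_pair_dev. Qed.

Lemma bmeas_far_sum a h r N : 0 < h < 1 -> bmeas (far_sum a h r N).
Proof. by move=> h01; apply: bmeas_sum => j; exact: bmeas_far_row. Qed.

Section Bounds.
Variables (a : nat -> R) (C h u v : R).

Lemma sep_err_ge0 : lacunary_by a C -> u <= v -> 0 <= sep_err a C u v.
Proof.
move=> la uv; have k0 := gap_ratio_gt0 la; have a1 := lac_gt0 la (leqnn 1).
by apply: addr_ge0; rewrite divr_ge0 ?mulr_ge0 ?(ltW k0) ?(ltW a1) ?subr_ge0.
Qed.

Lemma sep_err_bound j k r D d : lacunary_by a C -> 0 < h < 1 -> u <= v ->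
  (1 <= j)%N -> (j + r <= k)%N -> 0 <= d <= a j -> gap_ratio C * a k <= D ->
  (2 * h ^+ 2 + 2 * h * d * (v - u)) / D <= C ^- r * sep_err a C u v.
Proof.
move=> la /andP[h0 h1] uv j1 jk /andP[d0 dj] Dk.
have k0 := gap_ratio_gt0 la; have a1 := lac_gt0 la (leqnn 1).
have C0 : 0 < C ^+ r by case: la => _ C1 _; rewrite exprn_gt0//; lra.
have kk : (1 <= k)%N by lia.
have D0 : 0 < D by rewrite (lt_le_trans _ Dk)// mulr_gt0// (lac_gt0 la).
have V0 : 0 <= v - u by rewrite subr_ge0.
have aj := lac_gt0 la j1.
rewrite ler_pdivrMr// -[leRHS]mulrA ler_pdivlMl// [sep_err _ _ _ _ * _]mulrC.
have qk : C ^+ r * a j <= a k := lac_powle la j1 jk.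
apply: (@le_trans _ _ (C ^+ r * (2 + 2 * a j * (v - u)))).
  rewrite ler_pM2l//; apply: lerD.
    by rewrite ler_piMr// exprn_ile1// ltW.
  rewrite ler_wpM2r// -mulrA ler_pM2l// -[leRHS]mul1r ler_pM// ltW//.
apply: (@le_trans _ _ (gap_ratio C * a k * sep_err a C u v)); last first.
  by rewrite ler_wpM2r// sep_err_ge0.
have -> : gap_ratio C * a k * sep_err a C u v = a k * (2 / a 1%N + 2 * (v - u)).
  by rewrite /sep_err; field; rewrite !gt_eqF.
have -> : C ^+ r * (2 + 2 * a j * (v - u)) = (C ^+ r * a j) * (2 / a j + 2 * (v - u)).
  by field; rewrite gt_eqF.
apply: ler_pM => //.
- by rewrite mulr_ge0// ltW.
- by rewrite addr_ge0// ?mulr_ge0// invr_ge0 ltW.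
- by rewrite lerD2r ler_pM2l// lef_pV2 ?posrE// (lac_le la).
Qed.

Lemma pair_norm j k : lacunary_by a C -> 0 < h < 1 -> u <= v -> (1 <= j < k)%N ->
  itg u v (fun x => `|pair_dev a h j k x|) <=
  2 * h ^+ 2 * (v - u) + 2 * h / gap_ratio C * (a k)^-1.
Proof.
move=> la h01 uv /andP[j1 jk]; have k0 := gap_ratio_gt0 la; have D0 := lac_sub_gt0 la j1 jk.
rewrite (le_trans (itg_ctent_dilate_norm h01 uv D0))// lerD2l -[leRHS]mulrA -invfM.
have ak : 0 < a k by apply: (lac_gt0 la); lia.
have /andP[h0 _] := h01.
rewrite ler_wpM2l ?mulr_ge0//; first exact: ltW.
by rewrite lef_pV2 ?posrE ?mulr_gt0// lac_gap.
Qed.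

Lemma pair_sqr_far j k r : lacunary_by a C -> 0 < h < 1 -> u <= v -> (1 <= j)%N -> (j + r < k)%N ->
  itg u v (fun x => pair_dev a h j k x * pair_dev a h j k x) <=
  2 * h ^+ 3 * (v - u) + C ^- r * sep_err a C u v.
Proof.
move=> la h01 uv j1 jrk; have jk : (j < k)%N by lia.
have D0 := lac_sub_gt0 la j1 jk.
rewrite (le_trans (itg_ctent_dilate_sqr h01 uv D0))// lerD2l.
have := @sep_err_bound j k r (a k - a j) 0 la h01 uv j1 (ltnW jrk).
rewrite mulr0 mul0r addr0; apply; last exact: lac_gap.
by rewrite lexx ltW// (lac_gt0 la).
Qed.

Lemma pair_far i j k r : lacunary_by a C -> 0 < h < 1 -> u <= v ->
  (1 <= i < j)%N -> (j + r < k)%N ->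
  `|itg u v (fun x => pair_dev a h j k x * pair_dev a h i k x)| <=
  C ^- r * sep_err a C u v + 4 * h ^+ 3 / gap_ratio C * (a j)^-1.
Proof.
move=> la h01 uv /andP[i1 ij] jrk; have jk : (j < k)%N by lia.
have j1 : (1 <= j)%N by lia.
have D0 := lac_sub_gt0 la j1 jk; have d0 := lac_sub_gt0 la i1 ij.
have := itg_ctent_close h01 uv D0 d0.
have -> : a k - a j + (a j - a i) = a k - a i by ring.
move=> /le_trans; apply; apply: lerD.
  apply: (@sep_err_bound j k) => //; [exact: ltnW| |exact: lac_gap].
  by rewrite ltW//= gerBl ltW// (lac_gt0 la).
have /andP[h0 _] := h01.
rewrite -[leRHS]mulrA -invfM ler_wpM2l ?mulr_ge0 ?exprn_ge0// ?(ltW h0)//.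
by rewrite lef_pV2 ?posrE ?mulr_gt0 ?(gap_ratio_gt0 la) ?(lac_gt0 la)// lac_gap.
Qed.

Lemma pair_decorr i k j k' r : lacunary_by a C -> 0 < h < 1 -> u <= v ->
  (1 <= i < k)%N -> (1 <= j < k')%N -> (k + r <= k')%N ->
  `|itg u v (fun x => pair_dev a h i k x * pair_dev a h j k' x)| <=
  C ^- r * sep_err a C u v.
Proof.
move=> la h01 uv /andP[i1 ik] /andP[j1 jk] kk.
have D0 := lac_sub_gt0 la i1 ik; have D'0 := lac_sub_gt0 la j1 jk.
rewrite (le_trans (itg_ctent_decorr h01 uv D0 D'0))//.
apply: (@sep_err_bound k k') => //; [by lia| |exact: lac_gap].
by rewrite ltW//= gerBl ltW// (lac_gt0 la).
Qed.

(** For each [k] there are at most [r] near pairs; each contributes its mean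
    [O (h ^+ 2)] and a boundary term [O (h / a k)], and the latter are summable
    over [k]. *)
Lemma near_sum_norm r N : lacunary_by a C -> 0 < h < 1 -> u <= v ->
  itg u v (fun x => `|near_sum a h r N x|) <=
  r%:R * (2 * h ^+ 2 * (v - u) * N%:R + 2 * h / gap_ratio C * (gap_ratio C * a 1%N)^-1).
Proof.
move=> la h01 uv; have k0 := gap_ratio_gt0 la; have /andP[h0 _] := h01.
have bX j k := bmeas_pair_dev a j k h01.
have bX' j k := bmeas_norm (bX j k).
apply: (@le_trans _ _ (itg u v (fun x => \sum_(1 <= k < N.+1)
    \sum_(1 <= j < N.+1 | (j < k <= j + r)%N) `|pair_dev a h j k x|))).
  apply: le_itg.
  - exact/bmeas_norm/bmeas_near_sum.
  - by apply: bmeas_sum => k; apply: bmeas_sum.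
  - move=> x _; rewrite (le_trans (ler_norm_sum _ _ _))//.
    by apply: ler_sum => k _; exact: ler_norm_sum.
rewrite itg_sum//; last by move=> k; apply: bmeas_sum.
under eq_bigr do rewrite itg_sum//.
pose c k := 2 * h ^+ 2 * (v - u) + 2 * h / gap_ratio C * (a k)^-1.
have hk : 0 <= 2 * h / gap_ratio C by rewrite divr_ge0 ?mulr_ge0 ?ltW.
apply: (@le_trans _ _ (\sum_(1 <= k < N.+1) r%:R * c k)).
  rewrite big_seq [leRHS]big_seq; apply: ler_sum => k; rewrite mem_index_iota => /andP[k1 _].
  have c0 : 0 <= c k.
    by rewrite addr_ge0 ?mulr_ge0 ?sqr_ge0 ?invr_ge0 ?(ltW k0) ?(ltW h0)
      ?(ltW (lac_gt0 la k1)) ?subr_ge0.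
  apply: (@le_trans _ _ (\sum_(1 <= j < N.+1 | (j < k <= j + r)%N) c k)).
    rewrite big_seq_cond [leRHS]big_seq_cond; apply: ler_sum => j /andP[].
    rewrite mem_index_iota => /andP[j1 _] /andP[jk _].
    by apply: pair_norm => //; rewrite j1.
  by apply: (@sum_window _ _ (k - r)) => // j /andP[]; lia.
rewrite -mulr_sumr ler_wpM2l// big_split/= sum_cst_nat mulrC lerD2l -mulr_sumr.
by rewrite ler_wpM2l// lac_sum_inv.
Qed.

Definition far_row_const : R :=
  2 * (v - u) + 2 * sep_err a C u v + 8 / gap_ratio C * (gap_ratio C * a 1%N)^-1.

(** The diagonal terms are [O (h ^+ 3)] each.  An off-diagonal term [i < j] is
    [O (h ^+ 3 / a j)] up to a negligible error, and summing over [j] first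
    leaves [O (h ^+ 3)] for each of the [N] indices [i]. *)
Lemma far_row_sqr r N k : lacunary_by a C -> 0 < h < 1 -> u <= v -> (1 <= N)%N ->
  N%:R ^+ 2 * C ^- r <= h ^+ 3 ->
  itg u v (fun x => far_row a h r N k x * far_row a h r N k x) <=
  N%:R * h ^+ 3 * far_row_const.
Proof.
move=> la h01 uv N1 Nq; have k0 := gap_ratio_gt0 la; have /andP[h0 _] := h01.
have bX j := bmeas_pair_dev a j k h01.
have bXX i j := bmeasM (bX i) (bX j).
have q0 : 0 <= C ^- r by case: la => _ C1 _; rewrite invr_ge0 exprn_ge0//; lra.
have E0 := sep_err_ge0 la uv.
have h30 : 0 <= h ^+ 3 by rewrite exprn_ge0// ltW.
pose c := 2 * h ^+ 3 * (v - u) + C ^- r * sep_err a C u v.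
have c0 : 0 <= c.
  apply: addr_ge0; last exact: mulr_ge0.
  by apply: mulr_ge0; [exact: mulr_ge0|rewrite subr_ge0].
pose e := C ^- r * sep_err a C u v.
have e0 : 0 <= e by rewrite mulr_ge0.
pose g := 4 * h ^+ 3 / gap_ratio C.
have g0 : 0 <= g by rewrite divr_ge0 ?mulr_ge0 ?ltW.
have ia0 j : (1 <= j)%N -> 0 <= (a j)^-1 by move=> j1; rewrite invr_ge0 ltW// (lac_gt0 la).
(* [(a i)^-1 + (a j)^-1] bounds the inverse at the larger of the two indices
   and is symmetric. *)
pose B i j := (if i == j then c else 0) + (e + g * ((a i)^-1 + (a j)^-1)).
have B0 i j : (1 <= i)%N -> (1 <= j)%N -> 0 <= B i j.
  move=> i1 j1; rewrite addr_ge0//; first by case: ifP.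
  by rewrite addr_ge0// mulr_ge0// addr_ge0// ia0.
have XB i j : (1 <= i)%N -> (1 <= j)%N -> (i + r < k)%N -> (j + r < k)%N ->
  itg u v (fun x => pair_dev a h i k x * pair_dev a h j k x) <= B i j.
  move=> i1 j1 ik jk; rewrite /B.
  have [->|ij] := eqVneq i j.
    rewrite (le_trans (pair_sqr_far la h01 uv j1 jk))// lerDl.
    by rewrite addr_ge0// mulr_ge0// addr_ge0// ia0.
  rewrite add0r (le_trans (ler_norm _))//.
  have [ij'|ji] := ltnP i j.
    rewrite (eq_itg (g := fun x => pair_dev a h j k x * pair_dev a h i k x)); last first.
      by move=> x _; rewrite mulrC.
    rewrite (le_trans (pair_far la h01 uv (_ : (1 <= i < j)%N) jk))//; first by rewrite i1.
    by rewrite lerD2l ler_wpM2l// lerDr ia0.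
  have ji' : (j < i)%N by rewrite ltn_neqAle eq_sym ij.
  rewrite (le_trans (pair_far la h01 uv (_ : (1 <= j < i)%N) ik))//; first by rewrite j1.
  by rewrite lerD2l ler_wpM2l// lerDl ia0.
have -> : itg u v (fun x => far_row a h r N k x * far_row a h r N k x) =
   \sum_(1 <= i < N.+1 | (i + r < k)%N) \sum_(1 <= j < N.+1 | (j + r < k)%N)
   itg u v (fun x => pair_dev a h i k x * pair_dev a h j k x).
  rewrite /far_row; under eq_fun do rewrite big_distrlr /=.
  rewrite itg_sum//; last by move=> i; exact: bmeas_sum.
  by apply: eq_bigr => i _; rewrite itg_sum.
apply: (@le_trans _ _ (\sum_(1 <= i < N.+1) \sum_(1 <= j < N.+1) B i j)).
  apply: ler_sum_cond => i i1.
    by move=> ik; apply: ler_sum_cond => j j1; [move=> jk; exact: XB|exact: B0].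
  by rewrite big_seq sumr_ge0// => j; rewrite mem_index_iota => /andP[j1 _]; exact: B0.
apply: (@le_trans _ _ (\sum_(1 <= i < N.+1) (c + (N%:R * e +
   g * (N%:R * (a i)^-1 + (gap_ratio C * a 1%N)^-1))))).
  apply: ler_sum => i _; rewrite big_split/= -big_mkcond/= lerD//.
    have := @sum_window R N.+1 i 1 (fun j => i == j) c c0; rewrite mul1r; apply.
    by move=> j /eqP <-; rewrite leqnn addn1 ltnSn.
  rewrite big_split/= sum_cst_nat lerD2l -mulr_sumr ler_wpM2l// big_split/= sum_cst_nat.
  by rewrite lerD2l lac_sum_inv.
have sumE (x y z w : R) :
    \sum_(1 <= i < N.+1) (x + (y + z * (N%:R * (a i)^-1 + w))) =
    N%:R * x + (N%:R * y + z * (N%:R * \sum_(1 <= i < N.+1) (a i)^-1 + N%:R * w)).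
  by rewrite !big_split/= -!mulr_sumr !big_split/= !sum_cst_nat -mulr_sumr.
rewrite sumE.
have S := lac_sum_inv N la.
have N0 : 1 <= N%:R :> R by rewrite ler1n.
apply: (@le_trans _ _ (N%:R * c + (N%:R * (N%:R * e) +
  g * (N%:R * (gap_ratio C * a 1%N)^-1 + N%:R * (gap_ratio C * a 1%N)^-1)))).
  by rewrite !lerD2l ler_wpM2l// lerD2r ler_wpM2l.
have Ne : N%:R * (N%:R * e) <= N%:R * (h ^+ 3 * sep_err a C u v).
  apply: (@le_trans _ _ (h ^+ 3 * sep_err a C u v)).
    by rewrite /e mulrA -expr2 mulrA ler_wpM2r.
  by rewrite ler_peMl// mulr_ge0.
have e1 : e <= h ^+ 3 * sep_err a C u v.
  rewrite /e ler_wpM2r// (le_trans _ Nq)// ler_peMl//.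
  exact: exprn_ege1.
have Ne' : N%:R * c <= N%:R * (2 * h ^+ 3 * (v - u) + h ^+ 3 * sep_err a C u v).
  by rewrite ler_wpM2l// lerD2l.
apply: (le_trans (lerD Ne' (lerD Ne (lexx _)))).
by rewrite le_eqVlt; apply/orP; left; apply/eqP; rewrite /far_row_const /g; ring.
Qed.

Lemma far_row_decorr r N k k' : lacunary_by a C -> 0 < h < 1 -> u <= v -> (k + r <= k')%N ->
  itg u v (fun x => far_row a h r N k x * far_row a h r N k' x) <=
  N%:R ^+ 2 * (C ^- r * sep_err a C u v).
Proof.
move=> la h01 uv kk.
have bX j k := bmeas_pair_dev a j k h01.
have bXX i j := bmeasM (bX i k) (bX j k').
have q0 : 0 <= C ^- r by case: la => _ C1 _; rewrite invr_ge0 exprn_ge0//; lra.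
have e0 : 0 <= C ^- r * sep_err a C u v by rewrite mulr_ge0// sep_err_ge0.
have -> : itg u v (fun x => far_row a h r N k x * far_row a h r N k' x) =
   \sum_(1 <= i < N.+1 | (i + r < k)%N) \sum_(1 <= j < N.+1 | (j + r < k')%N)
   itg u v (fun x => pair_dev a h i k x * pair_dev a h j k' x).
  rewrite /far_row; under eq_fun do rewrite big_distrlr /=.
  rewrite itg_sum//; last by move=> i; exact: bmeas_sum.
  by apply: eq_bigr => i _; rewrite itg_sum.
apply: (@le_trans _ _ (\sum_(1 <= i < N.+1) \sum_(1 <= j < N.+1) C ^- r * sep_err a C u v)).
  apply: ler_sum_cond => i i1; last by rewrite sumr_ge0.
  move=> ik; apply: ler_sum_cond => j j1 // jk.
  by rewrite (le_trans (ler_norm _))// pair_decorr//; lia.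
by rewrite !sum_cst_nat expr2 mulrA.
Qed.

(** Each [k] has at most [2 * r] rows within distance [r], which are handled by
    [2 * x * y <= x ^+ 2 + y ^+ 2]; the other couples of rows are almost
    uncorrelated. *)
Lemma far_sum_sqr r N : lacunary_by a C -> 0 < h < 1 -> u <= v -> (1 <= N)%N -> (1 <= r)%N ->
  N%:R ^+ 2 * C ^- r <= h ^+ 3 ->
  itg u v (fun x => far_sum a h r N x * far_sum a h r N x) <=
  r%:R * N%:R ^+ 2 * h ^+ 3 * (2 * far_row_const + sep_err a C u v).
Proof.
move=> la h01 uv N1 r1 Nq; have /andP[h0 _] := h01.
have q0 : 0 <= C ^- r by case: la => _ C1 _; rewrite invr_ge0 exprn_ge0//; lra.
have E0 := sep_err_ge0 la uv.
have bY k := bmeas_far_row a r N k h01.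
have bYY k k' := bmeasM (bY k) (bY k').
pose e := N%:R ^+ 2 * (C ^- r * sep_err a C u v).
have e0 : 0 <= e by rewrite !mulr_ge0// exprn_ge0.
pose c := N%:R * h ^+ 3 * far_row_const.
have Y2 k : itg u v (fun x => far_row a h r N k x * far_row a h r N k x) <= c.
  exact: far_row_sqr.
have c0 : 0 <= c.
  by apply: le_trans (Y2 0); apply: itg_ge0 => x; rewrite -expr2 sqr_ge0.
have YY k k' : itg u v (fun x => far_row a h r N k x * far_row a h r N k' x) <=
    (if (k < k' + r)%N && (k' < k + r)%N then c else 0) + e.
  case: ifPn => [_|].
    rewrite (@le_trans _ _ c)// ?lerDl//.
    rewrite -(ler_pM2l (ltr0n _ 2)) -itgZ//.
    apply: (@le_trans _ _ (itg u v (fun x => far_row a h r N k x * far_row a h r N k x +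
      far_row a h r N k' x * far_row a h r N k' x))); last first.
      by rewrite itgD// mulr_natl mulr2n lerD.
    apply: le_itg; [by apply: bmeasM => //; exact: bmeas_cst|exact: bmeasD|].
    move=> x _; rewrite -subr_ge0.
    rewrite [leRHS](_ : _ = (far_row a h r N k x - far_row a h r N k' x) ^+ 2) ?sqr_ge0//.
    by ring.
  rewrite add0r negb_and -!leqNgt => /orP[kk|kk]; last exact: far_row_decorr.
  rewrite (eq_itg (g := fun x => far_row a h r N k' x * far_row a h r N k x)).
    exact: far_row_decorr.
  by move=> x _; rewrite mulrC.
have -> : itg u v (fun x => far_sum a h r N x * far_sum a h r N x) =
   \sum_(1 <= k < N.+1) \sum_(1 <= k' < N.+1)
   itg u v (fun x => far_row a h r N k x * far_row a h r N k' x).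
  rewrite /far_sum; under eq_fun do rewrite big_distrlr /=.
  rewrite itg_sum//; last by move=> i; exact: bmeas_sum.
  by apply: eq_bigr => i _; rewrite itg_sum.
apply: (@le_trans _ _ (\sum_(1 <= k < N.+1) ((2 * r)%:R * c + N%:R * e))).
  apply: ler_sum => k _; apply: (le_trans (ler_sum _ (fun k' _ => YY k k'))).
  rewrite big_split/= -big_mkcond/= sum_cst_nat lerD2r.
  by apply: (@sum_window _ _ (k - r)) => // k' /andP[]; lia.
rewrite sum_cst_nat.
have Ne : N%:R * (N%:R * e) <= r%:R * N%:R ^+ 2 * h ^+ 3 * sep_err a C u v.
  have -> : N%:R * (N%:R * e) = N%:R ^+ 2 * (N%:R ^+ 2 * C ^- r) * sep_err a C u v.
    by rewrite /e; move: (C ^- r) => q; ring.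
  have -> : r%:R * N%:R ^+ 2 * h ^+ 3 * sep_err a C u v =
     N%:R ^+ 2 * (r%:R * h ^+ 3) * sep_err a C u v by ring.
  rewrite ler_wpM2r// ler_wpM2l ?exprn_ge0// (le_trans Nq)//.
  by rewrite ler_peMl ?ler1n// exprn_ge0// ltW.
rewrite mulrDr (le_trans (lerD (lexx _) Ne))// le_eqVlt; apply/orP; left; apply/eqP.
by rewrite /c natrM; ring.
Qed.

End Bounds.
End PairSums.

(** * The exceptional set for fixed N *)

Section Deviation.
Context {R : realType}.
Implicit Types (a : nat -> R) (C h u v x l c delta : R) (i j k r N : nat).

(** Markov's inequality, for a majorant of the indicator of [A]. *)
Lemma measure_le_itg u v (A : set R) (f : R -> R) : u <= v -> measurable A ->
  (forall x, A x -> u <= x <= v) -> bmeas f -> (forall x, 0 <= f x) ->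
  (forall x, A x -> 1 <= f x) ->
  (lebesgue_measure A <= (itg u v f)%:E)%E.
Proof.
move=> uv mA Auv bf f0 f1.
have bA : bmeas (\1_A : R -> R).
  split; first exact: measurable_indic.
  by exists 1 => x; rewrite indicE; case: (_ \in _); rewrite ?normr0 ?normr1.
apply: (@le_trans _ _ (itg u v \1_A)%:E).
  rewrite /itg /Rintegral fineK; last first.
    by apply: integrable_fin_num => //; exact: (bmeas_integrable u v bA).
  rewrite integral_indic// setIidl// => x /Auv; by rewrite /= in_itv.
rewrite lee_fin; apply: le_itg => // x _; rewrite indicE.
by have [/set_mem/f1|] := boolP (x \in A).
Qed.

Lemma sum_sym_pairs N (s : nat -> nat -> R) : (forall j k, s j k = s k j) ->
  \sum_(1 <= j < N.+1) \sum_(1 <= k < N.+1) s j k =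
  \sum_(1 <= k < N.+1) s k k +
  2 * \sum_(1 <= k < N.+1) \sum_(1 <= j < N.+1 | (j < k)%N) s j k.
Proof.
move=> ss.
have split_row j : (1 <= j < N.+1)%N -> \sum_(1 <= k < N.+1) s j k =
    s j j + (\sum_(1 <= k < N.+1 | (k < j)%N) s k j + \sum_(1 <= k < N.+1 | (j < k)%N) s j k).
  move=> jN; rewrite (bigD1_seq j) ?iota_uniq ?mem_index_iota//=; congr (_ + _).
  rewrite (bigID (fun k => (k < j)%N))/=; congr (_ + _).
    apply: eq_big => [k|k _]; last exact: ss.
    by rewrite neq_ltn; case: ltngtP.
  by apply: eq_bigl => k; case: ltngtP.
have -> : \sum_(1 <= j < N.+1) \sum_(1 <= k < N.+1) s j k = \sum_(1 <= j < N.+1)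
   (s j j + (\sum_(1 <= k < N.+1 | (k < j)%N) s k j + \sum_(1 <= k < N.+1 | (j < k)%N) s j k)).
  by apply: eq_big_nat => j; exact: split_row.
rewrite !big_split/= mulr_natl mulr2n; congr (_ + (_ + _)).
by rewrite (exchange_big_dep xpredT).
Qed.

(** The mean [h ^+ 2] of the [N ^+ 2] tents cancels [l ^+ 2], and the diagonal of
    the centred sum is [l - h * l]. *)
Lemma Sigma2_dev a N l r x : (0 < N)%N -> 0 < l -> l / N%:R < 1 ->
  let h := l / N%:R in
  Sigma2 a N l x - l = 2 * (near_sum a h r N x + far_sum a h r N x) - h * l.
Proof.
move=> N0 l0 lN h; have h01 : 0 < h < 1 by rewrite divr_gt0 ?ltr0n.
have Nh : N%:R * h = l by rewrite /h mulrCA divff ?mulr1// pnatr_eq0 -lt0n.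
rewrite Sigma2E// -/h.
pose s j k := tent h (x * a j - x * a k).
have ss j k : s j k = s k j by rewrite /s -(tentN _ h01) opprB.
have sE j k : s j k = pair_dev a h j k x + h ^+ 2.
  by rewrite ss /s /pair_dev /ctent subrK -mulrBr mulrC.
have -> : \sum_(1 <= j < N.+1) \sum_(1 <= k < N.+1) s j k =
  \sum_(1 <= j < N.+1) \sum_(1 <= k < N.+1) pair_dev a h j k x + l ^+ 2.
  under eq_bigr do under eq_bigr do rewrite sE.
  under eq_bigr do rewrite big_split/= sum_cst_nat.
  by rewrite big_split/= sum_cst_nat -Nh; congr (_ + _); ring.
rewrite (@sum_sym_pairs _ (fun j k => pair_dev a h j k x)); last first.
  by move=> j k; apply: (addIr (h ^+ 2)); rewrite -!sE.
have -> : \sum_(1 <= k < N.+1) pair_dev a h k k x = l - h * l.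
  under eq_bigr do rewrite /pair_dev subrr mul0r /ctent tent0//.
  by rewrite sum_cst_nat -Nh; ring.
have -> : \sum_(1 <= k < N.+1) \sum_(1 <= j < N.+1 | (j < k)%N) pair_dev a h j k x =
    near_sum a h r N x + far_sum a h r N x.
  rewrite /near_sum /far_sum -big_split/=; apply: eq_bigr => k _.
  rewrite (bigID (fun j => (k <= j + r)%N))/=; congr (_ + _).
  by apply: eq_bigl => j; lia.
by ring.
Qed.

(** If the deviation exceeds [delta * l] while [h * l <= delta * l / 2], then the
    near or the far sum is at least [t = delta * l / 8] in absolute value; Markov's
    inequality is used for the first and Chebyshev's for the second. *)
Lemma measure_dev a C u v c delta : lacunary_by a C -> u <= v -> 0 < c -> 0 < delta ->
  exists2 K, 0 <= K & forall N r l (I : set R), let h := l / N%:R in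
    (1 <= N)%N -> (1 <= r)%N -> h < 1 -> c <= l -> h <= delta / 2 ->
    N%:R ^+ 2 * C ^- r <= h ^+ 3 ->
    measurable I -> (forall x, I x -> u <= x <= v) ->
    (lebesgue_measure [set x | I x /\ (delta * l < `|Sigma2 a N l x - l|)%R] <=
     (K * (r%:R * h))%:E)%E.
Proof.
move=> la uv c0 d0; have k0 := gap_ratio_gt0 la; have a1 := lac_gt0 la (leqnn 1).
set g := gap_ratio C in k0; set S0 := (g * a 1%N)^-1.
set K3 := 2 * far_row_const a C u v + sep_err a C u v.
have V0 : 0 <= v - u by rewrite subr_ge0.
have E0 := sep_err_ge0 la uv.
have S00 : 0 <= S0 by rewrite invr_ge0 mulr_ge0// ltW.
have g0 := ltW k0.
have K30 : 0 <= K3.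
  apply: addr_ge0 => //; apply: mulr_ge0 => //.
  apply: addr_ge0; first by apply: addr_ge0; apply: mulr_ge0.
  by apply: mulr_ge0 => //; exact: divr_ge0.
pose K := 8 / delta * (2 * (v - u) + 2 / g * S0 / c) + 64 / delta ^+ 2 * K3.
have c0' := ltW c0; have d0' := ltW d0.
exists K.
  apply: addr_ge0; last by apply: mulr_ge0 => //; rewrite divr_ge0 ?exprn_ge0.
  apply: mulr_ge0; first exact: divr_ge0.
  apply: addr_ge0; first exact: mulr_ge0.
  by apply: divr_ge0 => //; apply: mulr_ge0 => //; exact: divr_ge0.
move=> N r l I h N1 r1 h1 cl hd Nq mI Iuv.
have l0 : 0 < l by rewrite (lt_le_trans c0).
have NR0 : 0 < N%:R :> R by rewrite ltr0n.
have h01 : 0 < h < 1 by rewrite divr_gt0.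
have /andP[h0 _] := h01.
have Nh : N%:R * h = l by rewrite /h mulrCA divff ?mulr1// gt_eqF.
have bA := bmeas_near_sum a r N h01; have bB := bmeas_far_sum a r N h01.
pose A := near_sum a h r N; pose B := far_sum a h r N.
have devE x : Sigma2 a N l x - l = 2 * (A x + B x) - h * l by exact: Sigma2_dev.
pose t := delta * l / 8.
have t0 : 0 < t by rewrite divr_gt0// mulr_gt0.
pose f x := t^-1 * `|A x| + t ^- 2 * (B x * B x).
have bnA : bmeas (fun x => `|A x|) := bmeas_norm bA.
have bBB : bmeas (fun x => B x * B x) := bmeasM bB bB.
have bf : bmeas f by apply: bmeasD; apply: bmeasM => //; exact: bmeas_cst.
have tn0 : t != 0 by rewrite gt_eqF.
have ti0 : 0 <= t^-1 by rewrite invr_ge0 ltW.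
have t2 : 0 <= t ^- 2 by rewrite invr_ge0 exprn_ge0// ltW.
apply: (@le_trans _ _ (itg u v f)%:E).
  apply: measure_le_itg => //.
  - have -> : [set x | I x /\ (delta * l < `|Sigma2 a N l x - l|)%R] =
      I `&` (fun x => `|2 * (A x + B x) - h * l|) @^-1` `]delta * l, +oo[.
      apply/seteqP; split => x /=; rewrite in_itv/= andbT devE//.
    apply: measurableI => //; rewrite -[X in measurable X]setTI.
    suff [mf _] : bmeas (fun x => `|2 * (A x + B x) - h * l|) by exact: mf.
    apply: bmeas_norm; apply: bmeasB; last exact: bmeas_cst.
    by apply: bmeasM; [exact: bmeas_cst|exact: bmeasD].
  - by move=> x [/Iuv].
  - by move=> x; rewrite addr_ge0// mulr_ge0// -expr2 sqr_ge0.
  - move=> x [_]; rewrite devE => dev.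
    have [tA|At] := leP t `|A x|.
      rewrite -[leLHS]addr0 lerD//; last by rewrite mulr_ge0// -expr2 sqr_ge0.
      by rewrite -(mulVf tn0) ler_pM2l// invr_gt0.
    have tB : t <= `|B x|.
      have H1 := ler_normB (2 * (A x + B x)) (h * l).
      have H2 := ler_normD (A x) (B x).
      have H3 : `|h * l| <= delta / 2 * l.
        by rewrite ger0_norm ?(mulr_ge0 (ltW h0) (ltW l0))// ler_pM2r.
      move: H1; rewrite normrM (ger0_norm (ler0n _ 2)).
      move: dev At H2 H3; rewrite /t.
      have -> : delta / 2 * l = delta * l / 2 by ring.
      move: `|_ - _| `|A x + B x| `|A x| `|B x| `|h * l| (delta * l) => n1 n2 n3 n4 n5 n6.
      clear; lra.
    rewrite -[leLHS]add0r lerD//; first by rewrite mulr_ge0.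
    rewrite -(mulVf (expf_neq0 2 tn0)) ler_wpM2l//.
    by rewrite -expr2 -(real_normK (num_real (B x))) lerXn2r ?nnegrE// ltW.
rewrite lee_fin /f itgD; [|by apply: bmeasM => //; exact: bmeas_cst..].
rewrite !itgZ//.
have HA := near_sum_norm r N la h01 uv; rewrite -/g -/S0 in HA.
have HB := far_sum_sqr la h01 uv N1 r1 Nq; rewrite -/K3 in HB.
apply: (le_trans (lerD (ler_wpM2l ti0 HA) (ler_wpM2l t2 HB))).
have lE : l = N%:R * h by [].
have -> : t ^- 2 * (r%:R * N%:R ^+ 2 * h ^+ 3 * K3) = 64 / delta ^+ 2 * K3 * (r%:R * h).
  by rewrite /t lE; field; rewrite !gt_eqF.
rewrite /K [leRHS]mulrDl lerD2r.
have -> : t^-1 * (r%:R * (2 * h ^+ 2 * (v - u) * N%:R + 2 * h / g * S0)) =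
   8 / delta * (2 * (v - u) + 2 / g * S0 / l) * (r%:R * h).
  by rewrite /t lE; field; rewrite !gt_eqF.
apply: ler_wpM2r; first by rewrite mulr_ge0// ltW.
apply: ler_wpM2l; first exact: divr_ge0.
rewrite lerD2l; apply: ler_wpM2l; first by apply: mulr_ge0 => //; exact: divr_ge0.
by rewrite lef_pV2 ?posrE.
Qed.

End Deviation.

(** * Choice of the window and conclusion *)

(** [r] of order [ln N] makes [C ^+ r] as large as a given power of [N], and
    stays below a multiple of [N `^ (eps / 2)].  The exponent [6] is one more
    than the [5] needed for [N ^+ 2 * C ^- r <= h ^+ 3] when [h] is of order
    [1 / N]: the spare factor [N] absorbs the constant. *)
Lemma log_window (R : realType) (C eps : R) (N : nat) : 1 < C -> 0 < eps -> (1 <= N)%N ->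
  exists r : nat, [/\ (1 <= r)%N, N%:R ^+ 6 <= C ^+ r &
    r%:R <= (12 / (eps * ln C) + 1) * N%:R `^ (eps / 2)].
Proof.
move=> C1 e0 N1.
have C0 : 0 < C by lra.
have lC : 0 < ln C by rewrite ln_gt0.
have N0 : 0 < N%:R :> R by rewrite ltr0n.
have N1' : 1 <= N%:R :> R by rewrite ler1n.
have lN : 0 <= ln (N%:R : R) by rewrite ln_ge0.
pose y : R := 6 * ln N%:R / ln C.
have y0 : 0 <= y by rewrite divr_ge0 ?mulr_ge0// ltW.
exists (Num.trunc y).+1.
have /andP[ty yt] := trunc_itv y0.
split=> //.
  rewrite -ler_ln ?posrE ?exprn_gt0// !lnXn// -[leLHS]mulr_natl -[leRHS]mulr_natl.
  by rewrite -ler_pdivrMr// ltW.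
have P1 : 1 <= N%:R `^ (eps / 2).
  have := @ler_powR R N%:R N1' 0 (eps / 2).
  by rewrite powRr0; apply; rewrite divr_ge0// ltW.
have P0 : 0 < N%:R `^ (eps / 2) by exact: powR_gt0.
have lnP : eps / 2 * ln N%:R <= N%:R `^ (eps / 2) by rewrite -ln_powR ltW// ln_sublinear.
rewrite -natr1 mulrDl mul1r lerD// (le_trans ty)//.
have -> : y = 12 / (eps * ln C) * (eps / 2 * ln N%:R) by rewrite /y; field; rewrite !gt_eqF.
by rewrite ler_wpM2l// divr_ge0// mulr_ge0// ltW.
Qed.

Theorem theorem1p1 (R : realType) (a : nat -> R) (eps : R) (I : set R)
    (L : nat -> R)
    (a_lacunary : lacunary a)
    (eps_gt0 : 0 < eps)
    (I_interval : is_interval I) (I_bounded : bounded_set I)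
    (L_gt0 : forall N, (0 < N)%N -> 0 < L N)
    (L_bounded_below : exists2 c : R, 0 < c & forall N, (0 < N)%N -> c <= L N)
    (L_bigO : L =O_\oo (fun N : nat => N%:R `^ (1 - eps)))
    (delta : R) (delta_gt0 : 0 < delta) :
  exists K : R, \forall N \near \oo,
    (lebesgue_measure
       [set alpha | I alpha /\
          (delta * L N < `|Sigma2 a N (L N) alpha - L N|)%R]
     <= (K * N%:R `^ (- (eps / 2)))%:E)%E.
Proof.
have [a1 [C C1 aC]] := a_lacunary.
have la : lacunary_by a C by split.
have [c c0 cL] := L_bounded_below.
have [M [_ MI]] := I_bounded.
pose v := `|M| + 1.
have Iv x : I x -> - v <= x <= v.
  by move=> Ix; rewrite -ler_norml; apply: MI => //; rewrite /v ltr_pwDr// ler_norm.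
have vv : - v <= v by rewrite ge0_cp// addr_ge0.
have [K K0 HK] := measure_dev la vv c0 delta_gt0.
have /eqO_exP[B B0 LB] := L_bigO.
(* [N `^ eps >= T] and [h * N `^ eps <= B] force [h < 1] and [h <= delta / 2]. *)
pose T := B * (1 + 2 / delta) + 1.
have T0 : 0 < T by rewrite addr_gt0// mulr_gt0// addr_gt0// divr_gt0.
exists (K * (B * (12 / (eps * ln C) + 1))).
near=> N.
have N1 : (1 <= N)%N by near: N; exact: nbhs_infty_ge.
have N0 : 0 < N%:R :> R by rewrite ltr0n.
have Nn0 : N%:R != 0 :> R by rewrite gt_eqF.
have Nc : c ^- 3 <= N%:R by near: N; exact: nbhs_infty_ger.
have NT : T `^ eps^-1 <= N%:R by near: N; exact: nbhs_infty_ger.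
have LNB : `|L N| <= B * `|N%:R `^ (1 - eps)| by near: N.
pose h := L N / N%:R.
have L0 := L_gt0 N N1.
have h0 : 0 < h by rewrite divr_gt0.
have hB : h <= B * N%:R `^ (- eps).
  rewrite ler_pdivrMr// -mulrA -{2}(powRr1 (ltW N0)) -powRD ?Nn0 ?implybT//.
  by move: LNB; rewrite !ger0_norm ?powR_ge0 ?(ltW L0)// addrC.
have hN : h * N%:R `^ eps <= B.
  by move: hB; rewrite powRN ler_pdivlMr// powR_gt0.
have hT : h * T <= B.
  apply: le_trans hN; rewrite ler_pM2l//.
  have := @ge0_ler_powR _ eps (ltW eps_gt0) (T `^ eps^-1) N%:R.
  rewrite !nnegrE powR_ge0 (ltW N0) => /(_ isT isT NT).
  by rewrite -powRrM mulVf ?gt_eqF// powRr1// ltW.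
have h1 : h < 1.
  rewrite -(ltr_pM2r T0) mul1r (le_lt_trans hT)// /T.
  have : 0 < B * (2 / delta) by rewrite mulr_gt0// divr_gt0.
  by rewrite mulrDr mulr1; lra.
have hd : h <= delta / 2.
  have : h * (2 / delta) * B <= 1 * B.
    rewrite mul1r (le_trans _ hT)// -mulrA ler_pM2l// /T mulrDr mulr1 [_ * B]mulrC.
    by move: (B * _) => z; lra.
  by rewrite ler_pM2r// mulrA ler_pdivrMr// mul1r ler_pdivlMr.
have [r [r1 Cr rN]] := log_window C1 eps_gt0 N1.
have Nq : N%:R ^+ 2 * C ^- r <= h ^+ 3.
  have C0 : 0 < C ^+ r by rewrite exprn_gt0//; lra.
  have ch : c / N%:R <= h by rewrite ler_pM2r ?invr_gt0// cL.
  apply: (@le_trans _ _ ((c / N%:R) ^+ 3)); last first.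
    by rewrite lerXn2r ?nnegrE ?divr_ge0// ltW.
  rewrite ler_pdivrMr// (le_trans _ (ler_wpM2l _ Cr))//; last first.
    by rewrite exprn_ge0// divr_ge0// ltW.
  have -> : (c / N%:R) ^+ 3 * N%:R ^+ 6 = N%:R ^+ 2 * (c ^+ 3 * N%:R).
    by field; rewrite gt_eqF.
  rewrite ler_peMr// ?exprn_ge0 ?(ltW N0)//.
  by move: Nc; rewrite -[c ^- 3]mulr1 ler_pdivrMl ?exprn_gt0.
apply: (le_trans (HK N r (L N) I N1 r1 h1 (cL N N1) hd Nq _ Iv)).
  exact: is_interval_measurable.
rewrite lee_fin -!mulrA ler_wpM2l//.
apply: (le_trans (ler_pM _ _ rN hB)); rewrite ?ler0n ?(ltW h0)//.
have -> : N%:R `^ (- eps) = N%:R `^ (- (eps / 2)) * (N%:R `^ (eps / 2))^-1 :> R.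
  by rewrite -powRN -powRD ?Nn0 ?implybT//; congr (_ `^ _); lra.
rewrite le_eqVlt; apply/orP; left; apply/eqP.
move: (powR_gt0 (eps / 2) N0) (12 / _) => + w.
move: (_ `^ (eps / 2)) (_ `^ - (eps / 2)) => P Q P0.
by field; rewrite gt_eqF.
Unshelve. all: by end_near.
Qed.
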